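(* Let $p\ge 1$ and $n\ge 1$. The $\tfrac12 np(p+1)$-dimensional volume of the real moment space $\mathcal{M}_n(\mathbb{R})$ is $$\mathcal{V}(\mathcal{M}_n(\mathbb{R}))=\int_{\mathcal{M}_n(\mathbb{R})}dS_1\cdots dS_n=\prod_{k=1}^n B_p\!\left(\tfrac12 k(p+1),\tfrac12 k(p+1)\right).$$
   Context: $\mathcal{S}_p(\mathbb{R})$ is the space of real symmetric $p\times p$ matrices, with Lebesgue measure $dX=\prod_{i\le j}dx_{i,j}$ (product Lebesgue measure on the independent entries). A real matrix measure on $[0,1]$ is a $p\times p$ matrix $\mu=(\mu_{i,j})$ of signed Borel measures such that $\mu(A)$ is symmetric nonnegative definite for every Borel $A\subset[0,1]$, normalized by $\mu([0,1])=I_p$. Its moments are $S_k=\int_0^1x^k\,d\mu(x)$. The $n$th moment space is $\mathcal{M}_n(\mathbb{R})=\{(S_1,\dots,S_n)^T: S_j=\int_0^1x^jd\mu(x),\ j=1,\dots,n,\ \mu \text{ a real matrix measure on }[0,1]\}\subset(\mathcal{S}_p(\mathbb{R}))^n$. The multivariate Gamma function is $\Gamma_p(a)=\pi^{p(p-1)/4}\prod_{i=1}^p\Gamma(a-\tfrac12(i-1))$ for $a>\tfrac12(p-1)$, and the multivariate Beta function is $B_p(a,b)=\Gamma_p(a)\Gamma_p(b)/\Gamma_p(a+b)$ for $a,b>\tfrac12(p-1)$. *)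

(* Defs.v *)
From HB Require Import structures.
From mathcomp Require Import all_boot all_order all_algebra.
From mathcomp Require Import all_classical all_reals all_analysis.

Set Implicit Arguments.
Unset Strict Implicit.
Unset Printing Implicit Defensive.

Import Order.TTheory GRing.Theory Num.Theory.
Import numFieldNormedType.Exports.

Local Open Scope classical_set_scope.
Local Open Scope ring_scope.

Definition Gamma (R : realType) (a : R) : R :=
  fine (\int[lebesgue_measure]_(x in [set x : R | (0 < x)%R])
          (x `^ (a - 1) * expR (- x))%R%:E)%E.

Definition mGamma (R : realType) (p : nat) (a : R) : R :=
  pi `^ ((p * (p - 1))%:R / 4%:R) *
  \prod_(i < p) Gamma (a - i%:R / 2%:R).

Definition mBeta (R : realType) (p : nat) (a b : R) : R :=
  mGamma p a * mGamma p b / mGamma p (a + b).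

Definition psd (R : realType) (p : nat) (M : 'M[R]_p) : Prop :=
  forall v : 'cV[R]_p, 0 <= (v^T *m M *m v) ord0 ord0.

(* A p x p matrix of finite signed Borel measures on [0,1] is given as
   entrywise differences nu1 a b - nu2 a b of finite (nonnegative) Borel
   measures on R, restricted to Borel subsets of [0,1] (every finite
   signed measure on [0,1] arises this way, by its Jordan decomposition).
   [mmeasure nu1 nu2 A] is the matrix mu(A). *)
Definition mmeasure (R : realType) (p : nat)
  (nu1 nu2 : 'I_p -> 'I_p -> {finite_measure set R -> \bar R})
  (A : set R) : 'M[R]_p :=
  \matrix_(a, b) (fine (nu1 a b A) - fine (nu2 a b A)).

Definition mmoment (R : realType) (p : nat)
  (nu1 nu2 : 'I_p -> 'I_p -> {finite_measure set R -> \bar R})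
  (k : nat) : 'M[R]_p :=
  \matrix_(a, b)
    (fine (\int[nu1 a b]_(x in `[0%R, 1%R]%classic) (x ^+ k)%R%:E)%E
     - fine (\int[nu2 a b]_(x in `[0%R, 1%R]%classic) (x ^+ k)%R%:E)%E).

Definition is_matrix_measure01 (R : realType) (p : nat)
  (nu1 nu2 : 'I_p -> 'I_p -> {finite_measure set R -> \bar R}) : Prop :=
  (forall A : set R, measurable A -> A `<=` `[0%R, 1%R]%classic ->
     (mmeasure nu1 nu2 A)^T = mmeasure nu1 nu2 A /\ psd (mmeasure nu1 nu2 A))
  /\ mmeasure nu1 nu2 `[0%R, 1%R]%classic = 1%:M.

Definition moment_space (R : realType) (p n : nat) : set ('I_n -> 'M[R]_p) :=
  [set S | exists nu1 nu2 : 'I_p -> 'I_p -> {finite_measure set R -> \bar R},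
      is_matrix_measure01 nu1 nu2 /\
      forall j : 'I_n, S j = mmoment nu1 nu2 j.+1].

Definition upper_idx (p : nat) := {ab : 'I_p * 'I_p | (ab.1 <= ab.2)%N}.

Definition sym_coord (p n : nat) := ('I_n * upper_idx p)%type.

Definition upper_of (p : nat) (a b : 'I_p) : 'I_p * 'I_p :=
  if (a <= b)%N then (a, b) else (b, a).

Definition sym_of_coord (R : realType) (p n : nat)
  (x : sym_coord p n -> R) : 'I_n -> 'M[R]_p :=
  fun j => \matrix_(a, b)
    (match @insub _ (fun ab : 'I_p * 'I_p => (ab.1 <= ab.2)%N) (upper_idx p)
                  (upper_of a b) with
     | Some u => x (j, u)
     | None => 0
     end).

Fixpoint iter_lebesgue (R : realType) (I : eqType) (s : seq I)
  (f : (I -> R) -> \bar R) (x0 : I -> R) : \bar R :=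
  match s with
  | [::] => f x0
  | i :: s' => (\int[lebesgue_measure]_t
                  iter_lebesgue s' f (fun j => if j == i then t else x0 j))%E
  end.

Definition volume (R : realType) (I : finType) (A : set (I -> R)) : \bar R :=
  iter_lebesgue (enum I) (fun x => (\1_A x)%:E) (fun _ => 0).

(* dX = prod_{i<=j} dx_ij on (S_p(R))^n *)
Definition sym_volume (R : realType) (p n : nat)
  (E : set ('I_n -> 'M[R]_p)) : \bar R :=
  volume [set x : sym_coord p n -> R | E (sym_of_coord x)].

(* Main.v *)
Require Import Defs.
From HB Require Import structures.
From mathcomp Require Import all_boot all_order all_algebra.
From mathcomp Require Import all_classical all_reals all_analysis.
From mathcomp Require Import measurable_realfun.
From mathcomp Require Import complex sesquilinear spectral.
From mathcomp Require Import ring lra.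

(** The volume is computed by integrating the moments [S_n, ..., S_1] in this
    order.  If the block Hankel matrices of [S_0 = 1, S_1, ..., S_(k-1)] for the
    weights 1, x, 1-x and x(1-x) are positive definite, Schur complements show
    that the admissible [S_k] fill a Loewner interval of width
    [D_k = S_k^+ - S_k^-], and determinants of block matrices give
      [det D_(k+1) = det (S_k - S_k^-) * det (S_k^+ - S_k) / det D_k].
    Hence every step is a matrix Beta integral, of value a power of [det D_k]
    times a Beta constant.  The matrix Beta integral is computed by induction on
    the size, the Schur complement of the first entry splitting it into a scalar
    Beta integral, the integral of a power of [1 - |v|^2] over a ball, and a
    smaller matrix Beta integral.  Both recursions visit the coordinates in the
    order of [enum], so that only translations and dilations of the line are
    needed.
    Positive definite Hankel matrices come from a measure by Gauss quadrature,
    i.e. by the spectral theorem for multiplication by x; conversely the Hankel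
    matrices of a matrix measure are limits of positive semidefinite Riemann
    sums.  A homothety of ratio close to 1 centred at an interior point moves
    the latter sequences into the interior, so the boundary does not count. *)

Set Implicit Arguments.
Unset Strict Implicit.
Unset Printing Implicit Defensive.

Import Order.TTheory GRing.Theory Num.Theory.
Import numFieldNormedType.Exports.
Import HBSimple HBNNSimple.

Local Open Scope classical_set_scope.
Local Open Scope ring_scope.

(** * Integrals over the line *)

Section Integral.
Context {R : realType}.
Notation mu := (@lebesgue_measure R).
Implicit Types f g : R -> \bar R.
Local Open Scope ereal_scope.

(** The volume is an iterated integral of an indicator not known to be measurable, so neither
    Tonelli nor a change of variables in several dimensions is applied to it. What survives is
    monotonicity, homogeneity and affine substitution in one real variable. Hence no Loewner
    interval is ever normalised to [0, I]: the matrix Beta integral is proved for arbitrary ends.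
    For the same reason no null boundary is discarded; the value is squeezed. The sequences with
    positive definite Hankel matrices lie in the moment space and give the lower bound. A homothety
    of ratio a gives the upper bound a^(-N) times the same value, N being the number of coordinates,
    and a tends to 1. Tonelli serves only for explicit functions on the plane, in the scalar Beta
    and ball integrals. The arguments k(p+1)/2 arise because every integration raises the exponent
    of the determinant of the width by (p+1)/2; the first width is the identity, so only constants
    remain. *)

Lemma int_ge0 f : (forall x, 0 <= f x) -> 0 <= \int[mu]_x f x.
Proof. by move=> f0; apply: integral_ge0. Qed.

(* No measurability is assumed here nor in [intZl] and [int_affine]: nothing is
   known about the measurability of a partially integrated indicator. *)
Lemma le_int f g : (forall x, 0 <= f x) -> (forall x, f x <= g x) ->
  \int[mu]_x f x <= \int[mu]_x g x.
Proof.
move=> f0 fg; have g0 x : 0 <= g x by exact: le_trans (f0 x) (fg x).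
rewrite !ge0_integralTE//; apply: le_ereal_sup => _ [h hf <-]; exists h => // x.
exact: le_trans (hf x) (fg x).
Qed.


(** The integral is a supremum over simple functions, so an upper bound need only be checked on
    measurable minorants, for which the usual calculus is available. *)
Lemma int_le_mfun f B : (forall x, 0 <= f x) ->
  (forall h : R -> R, measurable_fun setT h -> (forall x, 0 <= h x)%R ->
    (forall x, (h x)%:E <= f x) -> \int[mu]_x (h x)%:E <= B) ->
  \int[mu]_x f x <= B.
Proof.
move=> f0 H; rewrite ge0_integralTE//; apply: ge_ereal_sup => _ [h hf <-].
have -> : sintegral mu h = \int[mu]_x (h x)%:E.
  by rewrite integral_nnsfun// patch_setT.
by apply: H => //; exact: (measurable_funPT h).
Qed.

Lemma intZl k f : (0 <= k)%R -> (forall x, 0 <= f x) ->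
  \int[mu]_x (k%:E * f x) = k%:E * \int[mu]_x f x.
Proof.
rewrite le_eqVlt => /predU1P[<- f0|k0 f0].
  by rewrite mul0e integral0_eq// => x _; rewrite mul0e.
have aux c g : (0 < c)%R -> (forall x, 0 <= g x) ->
    \int[mu]_x (c%:E * g x) <= c%:E * \int[mu]_x g x.
  move=> c0 g0; apply: int_le_mfun => [x|h mh h0 hg].
    by apply: mule_ge0; rewrite // lee_fin ltW.
  rewrite muleC -lee_pdivrMr// muleC -ge0_integralZl//.
  - apply: le_int => x; first by rewrite -EFinM lee_fin mulr_ge0// invr_ge0 ltW.
    by rewrite muleC lee_pdivrMr// muleC.
  - by apply/measurable_EFinP.
  - by move=> x _; rewrite lee_fin.
  - by rewrite lee_fin invr_ge0 ltW.
apply/eqP; rewrite eq_le aux//=.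
(* The reverse inequality is [aux] again, with [k^-1] and the function [k * f]. *)
rewrite muleC -lee_pdivlMr// muleC.
under [leLHS]eq_integral => x _.
  rewrite (_ : f x = k^-1%:E * (k%:E * f x)); last first.
    by rewrite muleA -EFinM mulVf ?gt_eqF// mul1e.
  over.
apply: aux; first by rewrite invr_gt0.
by move=> x; apply: mule_ge0; rewrite // lee_fin ltW.
Qed.
End Integral.

Definition affine (R : realType) (a c : R) (x : measurableTypeR R) :
  measurableTypeR R := a * x + c.

Lemma measurable_affine (R : realType) (a c : R) :
  measurable_fun setT (affine a c).
Proof. by apply: measurable_funD => //; exact: measurable_funM. Qed.

Section Affine.
Context {R : realType}.
Notation mu := (@lebesgue_measure R).
Implicit Types f g : R -> \bar R.
Local Open Scope ereal_scope.

(** Multiplied by [a], the image measure gives every half-open interval its length, so uniqueness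
    identifies it with Lebesgue measure. *)
Lemma pushforward_affine (a c : R) (A : set R) :
  (0 < a)%R -> measurable A ->
  pushforward mu (affine a c) A = a^-1%:E * mu A.
Proof.
move=> agt0 mA.
have a0' : (0 <= a)%R by exact: ltW.
have ma := @measurable_affine R a c.
have E (B : set (measurableTypeR R)) : measurable B ->
    mu B = a%:E * pushforward mu (affine a c) B.
  apply: (@lebesgue_measure_unique R
    (mscale (NngNum a0') (pushforward mu (affine a c)))) => // X [[u v] /= _ <-].
  rewrite /mscale /= /pushforward.
  have -> : affine a c @^-1` `]u, v]%classic = `]((u - c)/a)%R, ((v - c)/a)%R]%classic.
    apply/seteqP; split => x /=; rewrite !in_itv/= /affine => /andP[h1 h2].
      by apply/andP; split; [rewrite ltr_pdivrMr// | rewrite ler_pdivlMr//]; lra.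
    move: h1 h2; rewrite ltr_pdivrMr// ler_pdivlMr// => h1 h2.
    by apply/andP; split; lra.
  rewrite !lebesgue_measure_itv/= !lte_fin ltr_pM2r ?invr_gt0// ltrD2r.
  case: ifPn => _; last by rewrite mule0.
  by rewrite -!EFinD -EFinM; congr EFin; field; rewrite gt_eqF.
by rewrite (E A mA) muleA -EFinM mulVf ?gt_eqF// mul1e.
Qed.

Lemma int_affine (a c : R) f : (0 < a)%R -> (forall x, 0 <= f x) ->
  \int[mu]_x f (a * x + c)%R = a^-1%:E * \int[mu]_x f x.
Proof.
have mE b d (g : R -> R) : (0 < b)%R -> measurable_fun setT g ->
    (forall x, 0 <= g x)%R ->
    \int[mu]_x (g (b * x + d)%R)%:E = b^-1%:E * \int[mu]_x (g x)%:E.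
  move=> b0 mg g0.
  have b0' : (0 <= b^-1)%R by rewrite invr_ge0 ltW.
  have mg' : measurable_fun setT (EFin \o g) by exact/measurable_EFinP.
  have g0' : {in setT, forall y, 0 <= (EFin \o g) y}.
    by move=> y _; rewrite lee_fin.
  have := @ge0_integral_pushforward _ _ _ _ R (affine b d)
    (measurable_affine b d) mu setT (EFin \o g) measurableT mg' g0'.
  rewrite preimage_setT => <-.
  rewrite (eq_measure_integral (mscale (NngNum b0') mu)); first last.
  - by move=> mab A mA _; exact: pushforward_affine.
  - exact: measurable_affine.
  by rewrite ge0_integral_mscale//= => x _; rewrite lee_fin.
have aux b d g : (0 < b)%R -> (forall x, 0 <= g x) ->
    \int[mu]_x g (b * x + d)%R <= b^-1%:E * \int[mu]_x g x.
  move=> b0 g0; apply: int_le_mfun => // h mh h0 hg.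
  (* A measurable minorant [h] of the substituted function is carried back to a minorant [k] of
     [g]. *)
  pose k (x : R) := h (b^-1 * x - b^-1 * d)%R.
  have -> : \int[mu]_x (h x)%:E = \int[mu]_x (k (b * x + d)%R)%:E.
    by apply: eq_integral => x _; congr (EFin (h _)); field; rewrite gt_eqF.
  rewrite mE//.
  - apply: lee_wpmul2l; first by rewrite lee_fin invr_ge0 ltW.
    apply: le_int => x; first by rewrite lee_fin h0.
    apply: le_trans (hg _) _; rewrite le_eqVlt; apply/orP; left; apply/eqP.
    by congr (g _); field; rewrite gt_eqF.
  - exact: (measurableT_comp mh (measurable_affine b^-1 _)).
  - by move=> x; exact: h0.
move=> a0 f0; apply/eqP; rewrite eq_le aux//=.
rewrite muleC lee_pdivrMr// muleC.
(* The inverse substitution gives the opposite inequality. *)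
have := @aux (a^-1)%R (- (a^-1 * c))%R (fun x => f (a * x + c)%R).
rewrite invrK invr_gt0 => /(_ a0 (fun x => f0 _)) => H.
apply: le_trans H; rewrite le_eqVlt; apply/orP; left; apply/eqP.
by apply: eq_integral => x _; congr (f _); field; rewrite gt_eqF.
Qed.

Lemma int_affineZ (a c k : R) f g : (0 < a)%R -> (0 <= k)%R ->
  (forall x, 0 <= f x) -> (forall x, 0 <= g x) ->
  (forall x, f (a * x + c)%R = k%:E * g x) ->
  \int[mu]_x f x = (a * k)%:E * \int[mu]_x g x.
Proof.
move=> a0 k0 f0 g0 fg.
have E : \int[mu]_x f (a * x + c)%R = k%:E * \int[mu]_x g x.
  by rewrite -(intZl k0 g0); apply: eq_integral => x _; rewrite fg.
rewrite EFinM -muleA -E (int_affine c a0 f0) muleA -EFinM divff ?gt_eqF//.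
by rewrite mul1e.
Qed.

End Affine.

(** * Gamma and Beta integrals *)

(* [x `^ s] is 1 for [x < 0] and, when [s = 0], also at [x = 0]. *)
Definition ppow (R : realType) (x s : R) : R := if 0 < x then x `^ s else 0.

Section PPow.
Context {R : realType}.
Implicit Types x y s t : R.

Lemma ppow_ge0 x s : 0 <= ppow x s.
Proof. by rewrite /ppow; case: ifP => // _; exact: powR_ge0. Qed.

Lemma ppow_pos x s : 0 < x -> ppow x s = x `^ s.
Proof. by rewrite /ppow => ->. Qed.

Lemma ppow_neg x s : x <= 0 -> ppow x s = 0.
Proof. by rewrite /ppow ltNge => ->. Qed.

Lemma ppowMl x y s : 0 < x -> ppow (x * y) s = x `^ s * ppow y s.
Proof.
move=> x0; rewrite /ppow pmulr_rgt0//; case: ifPn => y0; last by rewrite mulr0.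
by rewrite powRM// ltW.
Qed.

Lemma ppowD x s t : ppow x (s + t) = ppow x s * ppow x t.
Proof.
rewrite /ppow; case: ifPn => x0; last by rewrite mulr0.
by rewrite powRD// (gt_eqF x0) implybT.
Qed.

Lemma measurable_ppow s : measurable_fun [set: R] (fun x => ppow x s).
Proof.
apply: measurable_fun_ifT => //; exact: measurable_fun_ltr.
Qed.

(** From ln y <= y - 1 at y = x/(2s) one gets s ln x <= s ln(2s) + x/2. The factor 2 of the constant
    cancels the rate 1/2 in the exponential density, whose integral is 1; this makes the Gamma
    integral finite. *)
Lemma ppow_le_exp s : 0 <= s -> exists2 C, 0 <= C &
  forall x, ppow x s * expR (- x) <= C * exponential_pdf 2^-1 x.
Proof.
move=> s0; exists (2 * expR (s * ln (2 * s))) => [|x]; first by rewrite mulr_ge0// expR_ge0.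
rewrite /ppow; case: ifPn => x0; last by rewrite mul0r !mulr_ge0// ?expR_ge0// exponential_pdf_ge0//.
rewrite exponential_pdfE; last exact: ltW.
rewrite [leRHS](_ : _ = expR (s * ln (2 * s)) * expR (- 2^-1 * x)); last first.
  by field.
rewrite /powR gt_eqF// -!expRD ler_expR.
have [s00|sn0] := eqVneq s 0; first by rewrite s00 !mul0r; lra.
have sp : 0 < 2 * s by rewrite mulr_gt0// lt_neqAle eq_sym sn0.
have := @le_ln1Dx R (x / (2 * s) - 1).
have xs : 0 < x / (2 * s) by rewrite divr_gt0.
rewrite (addrC 1) subrK ltrBrDr addNr => /(_ xs).
rewrite lnM ?posrE ?invr_gt0// lnV ?posrE// => H.
have {}H : s * (ln x - ln (2 * s)) <= s * (x / (2 * s) - 1) by rewrite ler_wpM2l.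
have E : s * (x / (2 * s)) = 2^-1 * x by field.
rewrite mulrBr mulrBr mulr1 E in H; lra.
Qed.

End PPow.

Section GammaBeta.
Context {R : realType}.
Notation mu := (@lebesgue_measure R).
Local Open Scope ereal_scope.

Definition Gint (s : R) : \bar R := \int[mu]_x (ppow x s * expR (- x))%:E.

Lemma Gint_fin s : (0 <= s)%R -> 0 < Gint s < +oo.
Proof.
move=> s0; apply/andP; split.
  apply: (@lt_le_trans _ _ (\int[mu]_x ((expR (- 2))%:E * (\1_(`[1%R, 2%R] : set R) x)%:E))).
    rewrite intZl ?expR_ge0//.
    rewrite integral_indic// setIT /= lebesgue_measure_itv/= lte_fin ltr1n.
    by rewrite -EFinD -EFinM lte_fin mulr_gt0 ?expR_gt0//; lra.
  apply: le_int => x; first by rewrite -EFinM lee_fin mulr_ge0// expR_ge0.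
  rewrite -EFinM lee_fin indicE; case: (boolP (x \in _)); last first.
    by rewrite mulr0 mulr_ge0 ?ppow_ge0 ?expR_ge0.
  rewrite inE/= in_itv/= => /andP[x1 x2]; rewrite mulr1 ppow_pos; last lra.
  rewrite -[leLHS]mul1r ler_pM ?expR_ge0// ?ler_expR; last lra.
  by rewrite -(powRr0 x) ler_powR.
have [C C0 HC] := ppow_le_exp s0.
apply: (@le_lt_trans _ _ (\int[mu]_x (C%:E * (exponential_pdf 2^-1 x)%:E))).
  apply: le_int => x; first by rewrite lee_fin mulr_ge0 ?ppow_ge0 ?expR_ge0.
  by rewrite -EFinM lee_fin.
rewrite intZl//; last by move=> x; rewrite lee_fin exponential_pdf_ge0.
by rewrite integral_exponential_pdf ?invr_gt0// mule1 ltry.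
Qed.

Lemma GintE s : (0 <= s)%R -> Gint s = (Gamma (s + 1))%:E.
Proof.
move=> s0; have /andP[G0 Gy] := Gint_fin s0.
have E : Gint s = \int[mu]_(x in [set x : R | (0 < x)%R]) (x `^ (s + 1 - 1) * expR (- x))%:E.
  rewrite [RHS]integral_mkcond; apply: eq_integral => x _.
  rewrite patchE /ppow addrK; case: ifPn => x0; first by rewrite ifT// inE.
  by rewrite mul0r ifF//; apply/negP; rewrite inE/= => x1; rewrite x1 in x0.
by rewrite /Gamma -E fineK// ge0_fin_numE// ltW.
Qed.

Lemma Gamma_gt0 (a : R) : (1 <= a)%R -> (0 < Gamma a)%R.
Proof.
move=> a1; have a0 : (0 <= a - 1)%R by rewrite subr_ge0.
have /andP[+ _] := Gint_fin a0.
by rewrite (GintE a0) subrK lte_fin.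
Qed.

(* Tonelli applied to [ppow (rho - h t) s * w t * expR (- rho)]. *)
Lemma weighted_ppow_integral (h w : R -> R) (s r : R) (c : \bar R) :
  (0 <= s)%R -> measurable_fun setT h -> measurable_fun setT w -> (forall t, 0 <= w t)%R ->
  0 <= c ->
  (forall rho, \int[mu]_t (ppow (rho - h t) s * w t)%:E = (ppow rho r)%:E * c) ->
  Gint r * c = Gint s * \int[mu]_t (w t * expR (- h t))%:E.
Proof.
move=> s0 mh mw w0 c0 H.
pose F (z : R * R) : \bar R := (ppow (z.2 - h z.1) s * w z.1 * expR (- z.2))%:E.
have F0 z : 0 <= F z by rewrite lee_fin !mulr_ge0 ?ppow_ge0 ?expR_ge0.
have mF : measurable_fun setT F.
  apply/measurable_EFinP; apply: measurable_funM; last first.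
    by apply: measurableT_comp => //; exact: measurableT_comp.
  apply: measurable_funM; last exact: measurableT_comp.
  apply: (measurableT_comp (measurable_ppow s)).
  by apply: measurable_funB => //; exact: measurableT_comp.
have := @fubini_tonelli _ _ _ _ _ mu mu F mF F0.
rewrite /F /= {mF F0 F} => FT.
(* Integrating t first, the scaling law leaves the Gamma integral of exponent [r]. *)
transitivity (\int[mu]_y \int[mu]_x (ppow (y - h x) s * w x * expR (- y))%:E).
  have mG : measurable_fun setT (fun y : R => (ppow y r * expR (- y))%:E).
    apply/measurable_EFinP; apply: measurable_funM; first exact: measurable_ppow.
    exact: measurableT_comp.
  have G0 (y : R) : setT y -> 0 <= (ppow y r * expR (- y))%:E.
    by rewrite lee_fin mulr_ge0 ?ppow_ge0 ?expR_ge0.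
  have := @ge0_integralZr _ _ _ mu setT measurableT _ mG c G0 c0.
  rewrite -/(Gint r) => <-.
  apply: eq_integral => y _.
  have -> : (ppow y r * expR (- y))%:E * c = (expR (- y))%:E * ((ppow y r)%:E * c).
    by rewrite muleA -EFinM mulrC.
  rewrite -H.
  transitivity (\int[mu]_x ((expR (- y))%:E * (ppow (y - h x) s * w x)%:E)).
    apply/esym/intZl; first exact: expR_ge0.
    by move=> t; rewrite lee_fin; apply: mulr_ge0; [exact: ppow_ge0|exact: w0].
  by apply: eq_integral => t _; rewrite -EFinM mulrC.
rewrite -FT.
transitivity (\int[mu]_x (Gint s * (w x * expR (- h x))%:E)); last first.
  rewrite (GintE s0); apply: intZl.
    by apply: ltW; apply: Gamma_gt0; rewrite lerDr.
  by move=> t; rewrite lee_fin; apply: mulr_ge0; [exact: w0|exact: expR_ge0].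
apply: eq_integral => t _; rewrite muleC.
have k0 : (0 <= w t * expR (- h t))%R.
  by apply: mulr_ge0; [exact: w0|exact: expR_ge0].
(* For fixed t, translating rho by [h t] splits the exponential. *)
transitivity (\int[mu]_y ((w t * expR (- h t))%:E *
   (ppow (y - h t) s * expR (- (y - h t)))%:E)).
  apply: eq_integral => y _; rewrite -EFinM; congr EFin.
  rewrite (_ : expR (- y) = expR (- h t) * expR (- (y - h t)))%R; first by ring.
  by rewrite -expRD; congr expR; ring.
rewrite (intZl k0); last first.
  by move=> y; rewrite lee_fin; apply: mulr_ge0; [exact: ppow_ge0|exact: expR_ge0].
congr (_ * _).
have := @int_affine R 1 (- h t) (fun x => (ppow x s * expR (- x))%:E) ltr01.
rewrite invr1 mul1e -/(Gint s) => <-.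
  by apply: eq_integral => y _; rewrite mul1r.
by move=> y; rewrite lee_fin; apply: mulr_ge0; [exact: ppow_ge0|exact: expR_ge0].
Qed.

Lemma mule_eq_div (x y z : R) (c : \bar R) : (0 < x)%R ->
  x%:E * c = y%:E * z%:E -> c = (y * z / x)%:E.
Proof.
move=> x0 E; rewrite -(mul1e c) -(mulVf (lt0r_neq0 x0)) EFinM -muleA E -!EFinM.
by rewrite mulrC.
Qed.

Lemma beta_scaling (a b rho : R) :
  \int[mu]_t (ppow (rho - t) b * ppow t a)%:E =
  (ppow rho (a + b + 1))%:E * \int[mu]_t (ppow (1 - t) b * ppow t a)%:E.
Proof.
have p0 (x y : R) : 0 <= (ppow x b * ppow y a)%:E.
  by rewrite lee_fin mulr_ge0 ?ppow_ge0.
have [r0|r0] := ltP 0%R rho; last first.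
  rewrite (ppow_neg _ r0) mul0e integral0_eq// => x _.
  have [x0|x0] := ltP 0%R x; last by rewrite (ppow_neg _ x0) mulr0.
  by rewrite (@ppow_neg _ (rho - x))%R ?mul0r//; lra.
have rn : rho != 0%R by rewrite gt_eqF.
have -> : ppow rho (a + b + 1) = (rho * (rho `^ a * rho `^ b))%R.
  by rewrite ppow_pos// !powRD ?rn ?implybT// powRr1 ?ltW//; ring.
apply: (@int_affineZ R rho 0%R) => // [|t].
  by apply: mulr_ge0; exact: powR_ge0.
rewrite -EFinM addr0; congr EFin.
rewrite (_ : rho - rho * t = rho * (1 - t))%R; last by ring.
by rewrite !ppowMl//; ring.
Qed.

(** The case [h = id], [w = ppow ^~ a]: the integral left on the right is again a Gamma integral. *)
Lemma beta_integral (a b : R) : (0 <= a)%R -> (0 <= b)%R ->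
  \int[mu]_t (ppow (1 - t) b * ppow t a)%:E =
  (Gamma (a + 1) * Gamma (b + 1) / Gamma (a + b + 2))%:E.
Proof.
move=> a0 b0; have ab0 : (0 <= a + b + 1)%R by lra.
pose c := \int[mu]_t (ppow (1 - t) b * ppow t a)%:E.
have c0 : 0 <= c.
  by apply: int_ge0 => t; rewrite lee_fin; apply: mulr_ge0; exact: ppow_ge0.
have := @weighted_ppow_integral id (fun t => ppow t a) b (a + b + 1)%R c b0
  (@measurable_id _ _ _) (measurable_ppow a) (ppow_ge0^~ a) c0 (beta_scaling a b).
rewrite -/c -/(Gint a) (GintE a0) (GintE b0) (GintE ab0) => H.
have G0 : (0 < Gamma (a + b + 1 + 1))%R by rewrite Gamma_gt0//; lra.
have -> : (a + b + 2 = a + b + 1 + 1)%R by ring.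
rewrite (mulrC (Gamma (a + 1))); exact: (mule_eq_div G0).
Qed.

Lemma ball_scaling (s rho : R) :
  \int[mu]_t (ppow (rho - t ^+ 2) s)%:E =
  (ppow rho (s + 2^-1))%:E * \int[mu]_t (ppow (1 - t ^+ 2) s)%:E.
Proof.
have [r0|r0] := ltP 0%R rho; last first.
  rewrite (ppow_neg _ r0) mul0e integral0_eq// => x _.
  by rewrite ppow_neg//; have := sqr_ge0 x; lra.
have q0 : (0 < Num.sqrt rho)%R by rewrite sqrtr_gt0.
have rn : rho != 0%R by rewrite gt_eqF.
have -> : ppow rho (s + 2^-1) = (Num.sqrt rho * rho `^ s)%R.
  by rewrite ppow_pos// powRD ?rn ?implybT// powR12_sqrt ?ltW// mulrC.
apply: (@int_affineZ R (Num.sqrt rho) 0%R) => // [|x|x|t].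
- exact: powR_ge0.
- by rewrite lee_fin ppow_ge0.
- by rewrite lee_fin ppow_ge0.
rewrite -EFinM addr0; congr EFin.
rewrite exprMn sqr_sqrtr ?ltW// (_ : rho - rho * t ^+ 2 = rho * (1 - t ^+ 2))%R; last by ring.
by rewrite ppowMl.
Qed.

(** The case h(t) = t^2, w = 1: the integral left on the right is Gaussian, whence the square root
    of [pi]. *)
Lemma ball_integral (s : R) : (0 <= s)%R ->
  \int[mu]_t (ppow (1 - t ^+ 2) s)%:E =
  (Num.sqrt pi * Gamma (s + 1) / Gamma (s + 2^-1 + 1))%:E.
Proof.
move=> s0; have s20 : (0 <= s + 2^-1)%R by rewrite addr_ge0// invr_ge0.
pose c := \int[mu]_t (ppow (1 - t ^+ 2) s)%:E.
have c0 : 0 <= c by apply: int_ge0 => t; rewrite lee_fin; exact: ppow_ge0.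
have := @weighted_ppow_integral (fun t => t ^+ 2)%R (fun=> 1%R) s (s + 2^-1)%R c s0
  (exprn_measurable 2) (@measurable_cst _ _ _ _ _ _) (fun=> ler01) c0.
rewrite (GintE s0) (GintE s20) => H.
have {}H := H (fun rho => ltac:(rewrite /c -ball_scaling; apply: eq_integral => t _; rewrite mulr1; reflexivity)).
have G : \int[mu]_t (1 * expR (- t ^+ 2))%:E = (Num.sqrt pi)%:E :> \bar R.
  by rewrite -integralT_gauss; apply: eq_integral => t _; rewrite mul1r.
rewrite G in H.
have G0 : (0 < Gamma (s + 2^-1 + 1))%R by rewrite Gamma_gt0//; lra.
rewrite (mulrC (Num.sqrt pi)); exact: (mule_eq_div G0).
Qed.

End GammaBeta.

(** * Positive definite matrices *)

Definition pd (R : realType) (p : nat) (M : 'M[R]_p) : Prop :=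
  M^T = M /\ forall v : 'cV[R]_p, v != 0 -> 0 < (v^T *m M *m v) ord0 ord0.

Section PositiveDefinite.
Context {R : realType}.
Implicit Types p q : nat.

Lemma pd_psd p (M : 'M[R]_p) : pd M -> psd M.
Proof.
move=> [_ H] v; have [->|/H/ltW//] := eqVneq v 0.
by rewrite mulmx0 mxE.
Qed.

Lemma pd_congr p q (C : 'M[R]_(p, q)) (M : 'M[R]_p) :
  (forall v : 'cV_q, C *m v = 0 -> v = 0) -> pd M -> pd (C^T *m M *m C).
Proof.
move=> Ci [Ms Mp]; split; first by rewrite !trmx_mul trmxK Ms mulmxA.
move=> v v0; rewrite !mulmxA -trmx_mul -mulmxA; apply: Mp.
by apply: contra v0 => /eqP /Ci ->.
Qed.

Lemma psd_congr p q (C : 'M[R]_(p, q)) (M : 'M[R]_p) :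
  psd M -> psd (C^T *m M *m C).
Proof. by move=> Mp v; rewrite !mulmxA -trmx_mul -mulmxA; apply: Mp. Qed.

Lemma pd_congr_unit p (C M : 'M[R]_p) : C \in unitmx ->
  pd (C^T *m M *m C) <-> pd M.
Proof.
move=> Cu; split; last first.
  by apply: pd_congr => v /(congr1 (mulmx (invmx C))); rewrite mulKmx// mulmx0.
move=> H; have := @pd_congr _ _ (invmx C) (C^T *m M *m C).
rewrite !mulmxA -trmx_mul mulmxV// trmx1 mul1mx mulmxK//; apply=> // v.
by move=> /(congr1 (mulmx C)); rewrite mulKVmx// mulmx0.
Qed.

Lemma pd_unit p (M : 'M[R]_p) : pd M -> M \in unitmx.
Proof.
move=> [Ms Mp]; rewrite unitmxE unitfE; apply/negP => /det0P[v v0 vM].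
have := Mp v^T; rewrite trmx_eq0 => /(_ v0).
by rewrite trmxK vM mul0mx mxE ltxx.
Qed.

Lemma invmx_sym p (M : 'M[R]_p) : M^T = M -> (invmx M)^T = invmx M.
Proof. by move=> Ms; rewrite trmx_inv Ms. Qed.

Lemma pd_inv p (M : 'M[R]_p) : pd M -> pd (invmx M).
Proof.
move=> Mp; have Mu := pd_unit Mp.
apply/(@pd_congr_unit _ M) => //; rewrite (proj1 Mp) mulmxV// mul1mx.
exact: Mp.
Qed.

Lemma qf_block p q (A : 'M[R]_p) (C : 'M[R]_q) (u : 'cV_p) (w : 'cV_q) :
  (col_mx u w)^T *m block_mx A 0 0 C *m col_mx u w =
  u^T *m A *m u + w^T *m C *m w.
Proof.
by rewrite tr_col_mx mul_row_block mul_row_col !mulmx0 addr0 add0r.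
Qed.

Lemma pd_block_diag p q (A : 'M[R]_p) (C : 'M[R]_q) :
  pd (block_mx A 0 0 C) <-> pd A /\ pd C.
Proof.
split=> [[Ms Mp]|[Ap Cp]].
  move: Ms; rewrite tr_block_mx !trmx0 => /eq_block_mx[As _ _ Cs].
  split; split=> // v v0.
    have := Mp (col_mx v 0); rewrite col_mx_eq0 (negbTE v0) => /(_ isT).
    by rewrite qf_block mulmx0 addr0.
  have := Mp (col_mx 0 v); rewrite col_mx_eq0 (negbTE v0) andbF => /(_ isT).
  by rewrite qf_block mulmx0 add0r.
split=> [|v]; first by rewrite tr_block_mx !trmx0 (proj1 Ap) (proj1 Cp).
rewrite -(vsubmxK v); set u := usubmx v; set w := dsubmx v.
rewrite col_mx_eq0 negb_and qf_block mxE => /orP[u0|w0].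
  by rewrite ltr_wpDr ?(proj2 Ap)//; exact: pd_psd.
by rewrite ltr_wpDl ?(proj2 Cp)//; exact: pd_psd.
Qed.

(** * Schur complements with respect to either diagonal block *)

Section Schur.
Variables (p q : nat).
Implicit Types (A : 'M[R]_p) (B : 'M[R]_(p, q)) (C : 'M[R]_q).

Lemma block_schur_ul A B C : A^T = A -> A \in unitmx ->
  block_mx A B B^T C = (block_mx 1%:M (invmx A *m B) 0 1%:M)^T *m
    block_mx A 0 0 (C - B^T *m invmx A *m B) *m block_mx 1%:M (invmx A *m B) 0 1%:M.
Proof.
move=> As Au; rewrite tr_block_mx !trmx1 trmx0 trmx_mul invmx_sym//.
rewrite !mulmx_block !(mul1mx, mulmx1, mul0mx, mulmx0, addr0, add0r).
rewrite mulmxKV// mulKVmx//; congr block_mx.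
by rewrite mulmxA addrC subrK.
Qed.

Lemma block_schur_dr A B C : C^T = C -> C \in unitmx ->
  block_mx A B B^T C = (block_mx 1%:M 0 (invmx C *m B^T) 1%:M)^T *m
    block_mx (A - B *m invmx C *m B^T) 0 0 C *m block_mx 1%:M 0 (invmx C *m B^T) 1%:M.
Proof.
move=> Cs Cu; rewrite tr_block_mx !trmx1 trmx0 trmx_mul invmx_sym// trmxK.
rewrite !mulmx_block !(mul1mx, mulmx1, mul0mx, mulmx0, addr0, add0r).
rewrite mulmxKV// !mulmxA mulmxV// mul1mx; congr block_mx.
by rewrite subrK.
Qed.

Lemma det_schur_ul A B C : A^T = A -> A \in unitmx ->
  \det (block_mx A B B^T C) = \det A * \det (C - B^T *m invmx A *m B).
Proof.
move=> As Au; rewrite block_schur_ul// !det_mulmx det_tr !det_ublock !det1.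
by rewrite !mulr1 mul1r.
Qed.

Lemma det_schur_dr A B C : C^T = C -> C \in unitmx ->
  \det (block_mx A B B^T C) = \det C * \det (A - B *m invmx C *m B^T).
Proof.
move=> Cs Cu; rewrite block_schur_dr// !det_mulmx det_tr !det_lblock !det1.
by rewrite !mulr1 mul1r mulrC.
Qed.

Lemma pd_ul A B C : pd (block_mx A B B^T C) -> pd A.
Proof.
move=> H; have := pd_congr (C := col_mx 1%:M 0) _ H.
rewrite tr_col_mx trmx1 trmx0 mul_row_block mul_row_col.
rewrite !(mul1mx, mulmx1, mul0mx, mulmx0, addr0); apply => v.
by rewrite mul_col_mx mul1mx mul0mx => /eqP; rewrite col_mx_eq0 => /andP[/eqP].
Qed.

Lemma pd_dr A B C : pd (block_mx A B B^T C) -> pd C.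
Proof.
move=> H; have := pd_congr (C := col_mx 0 1%:M) _ H.
rewrite tr_col_mx trmx1 trmx0 mul_row_block mul_row_col.
rewrite !(mul1mx, mulmx1, mul0mx, mulmx0, addr0, add0r); apply => v.
by rewrite mul_col_mx mul1mx mul0mx => /eqP; rewrite col_mx_eq0 => /andP[_ /eqP].
Qed.

Lemma pd_schur_ul A B C :
  pd (block_mx A B B^T C) <-> pd A /\ pd (C - B^T *m invmx A *m B).
Proof.
suff H : pd A -> pd (block_mx A B B^T C) <-> pd A /\ pd (C - B^T *m invmx A *m B).
  by split=> [M|[Ap ?]]; [have Ap := pd_ul M|]; apply/(H Ap).
move=> Ap; rewrite block_schur_ul ?(proj1 Ap) ?pd_unit//.
rewrite -pd_block_diag; apply: pd_congr_unit.
by rewrite unitmxE det_ublock !det1 mulr1 unitr1.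
Qed.

Lemma pd_schur_dr A B C :
  pd (block_mx A B B^T C) <-> pd C /\ pd (A - B *m invmx C *m B^T).
Proof.
suff H : pd C -> pd (block_mx A B B^T C) <-> pd C /\ pd (A - B *m invmx C *m B^T).
  by split=> [M|[Ap ?]]; [have Ap := pd_dr M|]; apply/(H Ap).
move=> Cp; rewrite block_schur_dr ?(proj1 Cp) ?pd_unit//.
rewrite (and_comm (pd C)) -pd_block_diag; apply: pd_congr_unit.
by rewrite unitmxE det_lblock !det1 mulr1 unitr1.
Qed.
End Schur.

Lemma pd_scalar (x : R) : pd (x%:M : 'M[R]_1) <-> 0 < x.
Proof.
split=> [[_ /(_ 1%:M)]|x0].
  rewrite trmx1 mul1mx mulmx1 mxE eqxx mulr1n; apply.
  by apply/eqP => /matrixP/(_ ord0 ord0); rewrite !mxE eqxx => /eqP; rewrite oner_eq0.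
split=> [|v v0]; first by rewrite tr_scalar_mx.
rewrite mul_mx_scalar -scalemxAl mxE mulr_gt0// !mxE big_ord1 mxE -expr2.
rewrite exprn_even_gt0//=; apply: contra v0 => /eqP v0; apply/eqP/matrixP => i j.
by rewrite !ord1 v0 mxE.
Qed.

Lemma pd0 (M : 'M[R]_0) : pd M.
Proof. by split=> [|v /eqP[]]; apply/matrixP => -[]. Qed.

Lemma det_gt0 p (M : 'M[R]_p) : pd M -> 0 < \det M.
Proof.
elim: p M => [|p IH]; first by move=> M _; rewrite det_mx00.
rewrite -[p.+1]/(1 + p)%N => M; rewrite -[M]submxK; set A := ulsubmx M.
set B := ursubmx M; set C := drsubmx M => Mp.
have E : dlsubmx M = B^T.
  by have [+ _] := Mp; rewrite tr_block_mx => /eq_block_mx[_ <- _ _]; rewrite trmxK.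
move: Mp; rewrite E => Mp; have [Ap Sp] := (pd_schur_ul _ _ _).1 Mp.
rewrite det_schur_ul ?(proj1 Ap) ?pd_unit// mulr_gt0 ?IH//.
have := Ap; rewrite [A]mx11_scalar det_scalar1.
by move=> /pd_scalar.
Qed.

Lemma pdD p (A B : 'M[R]_p) : pd A -> B^T = B -> psd B -> pd (A + B).
Proof.
move=> [As Ap] Bs Bp; split; first by rewrite raddfD /= As Bs.
by move=> v v0; rewrite mulmxDr mulmxDl mxE ltr_wpDr ?Ap.
Qed.

Lemma pdZ p (k : R) (A : 'M[R]_p) : 0 < k -> pd A -> pd (k *: A).
Proof.
move=> k0 [As Ap]; split; first by rewrite linearZ /= As.
by move=> v v0; rewrite -scalemxAr -scalemxAl mxE mulr_gt0// Ap.
Qed.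

Lemma psdZ p (k : R) (A : 'M[R]_p) : 0 <= k -> psd A -> psd (k *: A).
Proof. by move=> k0 Ap v; rewrite -scalemxAr -scalemxAl mxE mulr_ge0. Qed.

End PositiveDefinite.

(** * The matrix Beta integral *)

Fixpoint rowint (R : realType) (q : nat) : ('rV[R]_q -> \bar R) -> \bar R :=
  match q with
  | 0 => fun f => f 0
  | q'.+1 => fun f => (\int[lebesgue_measure]_t
      rowint (fun v : 'rV[R]_q' => f (row_mx (t%:M : 'rV[R]_1) v)))%E
  end.

(** The corner, the rest of the first row, then the remaining block: this is the row-major order of
    the upper triangle, and it is also the shape of a Schur complement induction. *)
Fixpoint symint (R : realType) (p : nat) : ('M[R]_p -> \bar R) -> \bar R :=
  match p with
  | 0 => fun f => f 0
  | q.+1 => fun f => (\int[lebesgue_measure]_t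
      rowint (fun v : 'rV[R]_q =>
        symint (fun Y : 'M[R]_q => f (block_mx (t%:M : 'M[R]_1) v v^T Y))))%E
  end.

(** Cut off outside the positive definite cone, so that for [s = 0] it is the indicator of the
    cone. *)
Definition pdpow (R : realType) (p : nat) (M : 'M[R]_p) (s : R) : R :=
  if `[< pd M >] then \det M `^ s else 0.

Section NestedIntegrals.
Context {R : realType}.
Local Open Scope ereal_scope.

Lemma tr_block_sym q (t : R) (v : 'rV[R]_q) (Y : 'M[R]_q) : Y^T = Y ->
  (block_mx (t%:M : 'M[R]_1) v v^T Y)^T = block_mx (t%:M : 'M[R]_1) v v^T Y.
Proof. by move=> Ys; rewrite tr_block_mx tr_scalar_mx trmxK Ys. Qed.

Lemma rowint_ge0 q (f : 'rV[R]_q -> \bar R) : (forall v, 0 <= f v) -> 0 <= rowint f.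
Proof. by elim: q f => [|q IH] f f0 //=; apply: int_ge0 => t; exact: IH. Qed.

Lemma symint_ge0 p (f : 'M[R]_p -> \bar R) : (forall X, 0 <= f X) -> 0 <= symint f.
Proof.
elim: p f => [|q IH] f f0 //=; apply: int_ge0 => t; apply: rowint_ge0 => v.
exact: IH.
Qed.

Lemma eq_rowint q (f g : 'rV[R]_q -> \bar R) : f =1 g -> rowint f = rowint g.
Proof. by move=> /funext ->. Qed.

Lemma eq_symint p (f g : 'M[R]_p -> \bar R) : (forall X, X^T = X -> f X = g X) ->
  symint f = symint g.
Proof.
elim: p f g => [|q IH] f g fg /=; first by apply: fg; rewrite trmx0.
apply: eq_integral => t _; apply: eq_rowint => v; apply: IH => Y Ys.
by apply: fg; exact: tr_block_sym.
Qed.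

Lemma rowintZl q k (f : 'rV[R]_q -> \bar R) : (0 <= k)%R -> (forall v, 0 <= f v) ->
  rowint (fun v => k%:E * f v) = k%:E * rowint f.
Proof.
elim: q f => [|q IH] f k0 f0 //=; rewrite -intZl//; last first.
  by move=> t; apply: rowint_ge0.
by apply: eq_integral => t _; apply: IH.
Qed.

Lemma symintZl p k (f : 'M[R]_p -> \bar R) : (0 <= k)%R -> (forall v, 0 <= f v) ->
  symint (fun v => k%:E * f v) = k%:E * symint f.
Proof.
elim: p f => [|q IH] f k0 f0 //=; rewrite -intZl//; last first.
  by move=> t; apply: rowint_ge0 => v; apply: symint_ge0.
apply: eq_integral => t _; rewrite -rowintZl//.
  by apply: eq_rowint => v; apply: IH.
by move=> v; apply: symint_ge0.
Qed.

End NestedIntegrals.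

Section QuadraticForms.
Context {R : realType}.

(** With M = L^T diag(A, S) L and L unipotent, the row (u, w) equals (u, z) L, so the inverse form
    separates. This lets an ellipsoid be integrated one coordinate at a time. *)
Lemma qf_inv_block p q k (A : 'M[R]_p) (B : 'M[R]_(p, q)) (C : 'M[R]_q)
    (u : 'M[R]_(k, p)) (w : 'M[R]_(k, q)) :
  pd (block_mx A B B^T C) -> let z := w - u *m invmx A *m B in
  row_mx u w *m invmx (block_mx A B B^T C) *m (row_mx u w)^T =
  u *m invmx A *m u^T + z *m invmx (C - B^T *m invmx A *m B) *m z^T.
Proof.
move=> Mp z; have [Ap Sp] := (pd_schur_ul _ _ _).1 Mp.
have Au := pd_unit Ap; have Su := pd_unit Sp; have Mu := pd_unit Mp.
set M := block_mx _ _ _ _ in Mp Mu *; set S := C - _ in Sp Su *.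
set L := block_mx 1%:M (invmx A *m B) 0 1%:M : 'M[R]_(p + q).
have Lu : L \in unitmx by rewrite unitmxE det_ublock !det1 mulr1 unitr1.
have LTu : L^T \in unitmx by rewrite unitmx_tr.
have ME : M = L^T *m block_mx A 0 0 S *m L by exact/block_schur_ul/pd_unit/Ap/(proj1 Ap).
have Du : block_mx A 0 0 S \in unitmx by rewrite unitmxE det_ublock unitrM -!unitmxE Au.
have uL : row_mx u w = row_mx u z *m L.
  rewrite mul_row_block !mulmx1 mulmx0 addr0 /z mulmxA; congr row_mx.
  by rewrite addrC subrK.
have -> : invmx M = invmx L *m invmx (block_mx A 0 0 S) *m invmx L^T.
  by rewrite -[RHS](mulmxK Mu) {2}ME !mulmxA mulmxKV// mulmxKV// mulVmx// mul1mx.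
rewrite uL trmx_mul !mulmxA mulmxK// mulmxKV//.
have -> : invmx (block_mx A 0 0 S) = block_mx (invmx A) 0 0 (invmx S).
  by rewrite invmx_block_diag.
by rewrite tr_row_mx mul_row_block mul_row_col !mulmx0 addr0 add0r.
Qed.

Lemma pdpow_ge0 p (M : 'M[R]_p) s : 0 <= pdpow M s.
Proof. by rewrite /pdpow; case: ifP => // _; exact: powR_ge0. Qed.

Lemma pdpow_pd p (M : 'M[R]_p) s : pd M -> pdpow M s = \det M `^ s.
Proof. by move=> H; rewrite /pdpow asboolT. Qed.

Lemma pdpow_npd p (M : 'M[R]_p) s : ~ pd M -> pdpow M s = 0.
Proof. by move=> H; rewrite /pdpow asboolF. Qed.

Lemma invmx_scalar1 (x : R) : x != 0 -> invmx (x%:M : 'M[R]_1) = (x^-1)%:M.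
Proof. by move=> x0; rewrite invmx_scalar. Qed.

Lemma schur_scalar q (x : R) (v : 'rV[R]_q) (Y : 'M[R]_q) : 0 < x ->
  Y - v^T *m invmx (x%:M : 'M[R]_1) *m v = Y - x^-1 *: (v^T *m v).
Proof. by move=> x0; rewrite invmx_scalar1 ?gt_eqF// mul_mx_scalar -scalemxAl. Qed.

Lemma pd_block_scalar q (x : R) (v : 'rV[R]_q) (Y : 'M[R]_q) :
  pd (block_mx (x%:M : 'M[R]_1) v v^T Y) <-> 0 < x /\ pd (Y - x^-1 *: (v^T *m v)).
Proof.
split=> [/pd_schur_ul[/pd_scalar x0]|[x0 H]]; first by rewrite schur_scalar.
by apply/pd_schur_ul; split; [exact/pd_scalar|rewrite schur_scalar].
Qed.

Lemma det_block_scalar q (x : R) (v : 'rV[R]_q) (Y : 'M[R]_q) : 0 < x ->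
  \det (block_mx (x%:M : 'M[R]_1) v v^T Y) = x * \det (Y - x^-1 *: (v^T *m v)).
Proof.
move=> x0; rewrite det_schur_ul ?tr_scalar_mx// ?det_scalar1 ?schur_scalar//.
by rewrite unitmxE det_scalar1 unitfE gt_eqF.
Qed.

Lemma pdpow_block q (x : R) (v : 'rV[R]_q) (Y : 'M[R]_q) s :
  pdpow (block_mx (x%:M : 'M[R]_1) v v^T Y) s =
  ppow x s * pdpow (Y - x^-1 *: (v^T *m v)) s.
Proof.
have [x0|x0] := ltP 0 x; last first.
  rewrite ppow_neg// mul0r pdpow_npd// => /pd_block_scalar[x1 _].
  by rewrite ltNge x0 in x1.
have [H|H] := pselect (pd (Y - x^-1 *: (v^T *m v))); last first.
  by rewrite [in RHS]pdpow_npd// mulr0 pdpow_npd// => /pd_block_scalar[].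
rewrite !pdpow_pd//; last exact/pd_block_scalar.
by rewrite ppow_pos// det_block_scalar// powRM// ltW// det_gt0.
Qed.

Definition qinv q (E : 'M[R]_q) (z : 'rV[R]_q) : R := (z *m invmx E *m z^T) ord0 ord0.

(* Both sides are read off the two Schur complements of
   [block_mx (c^-1)%:M z z^T E]. *)
Lemma pdpow_rank1 q (c s : R) (E : 'M[R]_q) (z : 'rV[R]_q) : 0 < c -> pd E ->
  pdpow (E - c *: (z^T *m z)) s = \det E `^ s * c `^ s * ppow (c^-1 - qinv E z) s.
Proof.
move=> c0 Ep; have ci0 : 0 < c^-1 by rewrite invr_gt0.
have H := pd_block_scalar c^-1 z E; rewrite invrK in H.
have := det_block_scalar z E ci0; rewrite invrK => D.
have E2 : (c^-1)%:M - z *m invmx E *m z^T = (c^-1 - qinv E z)%:M :> 'M[R]_1.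
  by rewrite [z *m _ *m _]mx11_scalar -raddfB.
have D2 := det_schur_dr (c^-1)%:M z (proj1 Ep) (pd_unit Ep).
rewrite D E2 det_scalar1 in D2.
have [q0|q0] := ltP 0 (c^-1 - qinv E z); last first.
  rewrite [in RHS]ppow_neg// mulr0 pdpow_npd// => P.
  have /pd_schur_dr[_] := H.2 (conj ci0 P).
  by rewrite E2 => /pd_scalar; rewrite ltNge q0.
have P : pd (E - c *: (z^T *m z)).
  apply: (proj2 (H.1 _)); apply/pd_schur_dr; split=> //; rewrite E2; exact/pd_scalar.
rewrite pdpow_pd// ppow_pos// -!powRM ?mulr_ge0 ?ltW// ?det_gt0//.
by congr (_ `^ _); rewrite mulrAC -D2 mulrAC mulVf ?mul1r// gt_eqF.
Qed.

End QuadraticForms.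

(** * Integrals over ellipsoids, and of a determinant with a rank-one perturbation *)

Section BallIntegral.
Context {R : realType}.
Notation mu := (@lebesgue_measure R).

(** The integral of (1 - |v|^2)^s over the unit ball of R^q: one factor of [ball_integral] per
    coordinate, the exponent growing by 1/2 each time. *)
Fixpoint ballcst (q : nat) (s : R) : R :=
  if q is q'.+1 then ballcst q' s *
    (Num.sqrt pi * Gamma (s + q'%:R / 2 + 1) / Gamma (s + q'%:R / 2 + 2^-1 + 1))
  else 1.

Lemma ballcst_ge0 q s : 0 <= s -> 0 <= ballcst q s.
Proof.
move=> s0; elim: q => [|q IH] //=; rewrite mulr_ge0//.
by rewrite !mulr_ge0 ?sqrtr_ge0 ?invr_ge0 ?ltW// Gamma_gt0// lerDr !addr_ge0//.
Qed.

(** Induction on the first coordinate: for fixed t the rest of the row runs over an ellipsoid of the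
    Schur complement [F'] with smaller radius, and t itself then contributes a one-dimensional ball
    of scale [Num.sqrt d]. The scales multiply to the root of det E. *)
Lemma rowint_ball q (E : 'M[R]_q) (v0 : 'rV[R]_q) (s rho : R) : 0 <= s -> pd E ->
  rowint (fun v => (ppow (rho - qinv E (v - v0)) s)%:E) =
  (ppow rho (s + q%:R / 2) * (Num.sqrt (\det E) * ballcst q s))%:E.
Proof.
move=> s0; elim: q E v0 rho => [|q IH].
  move=> E v0 rho _ /=; rewrite det_mx00 sqrtr1 mul0r addr0 !mulr1.
  by rewrite /qinv mxE big_ord0 subr0.
rewrite -[q.+1]/(1 + q)%N => E v0 rho; rewrite -[E]submxK.
set r := ursubmx E; set F := drsubmx E; rewrite [ulsubmx E]mx11_scalar.
set d := ulsubmx E _ _ => Ep.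
have Er : dlsubmx E = r^T.
  by have [+ _] := Ep; rewrite tr_block_mx => /eq_block_mx[_ <- _ _]; rewrite trmxK.
rewrite Er in Ep *; have [d0 Fp] := (pd_block_scalar _ _ _).1 Ep.
rewrite -[v0]hsubmxK; set w := rsubmx v0; rewrite [lsubmx v0]mx11_scalar.
set tau := lsubmx v0 _ _.
set F' := F - _ in Fp.
rewrite /=.
transitivity (\int[mu]_t ((Num.sqrt (\det F') * ballcst q s)%:E *
   (ppow (rho - d^-1 * (t - tau) ^+ 2) (s + q%:R / 2))%:E))%E.
  apply: eq_integral => t _; rewrite -EFinM mulrC.
  (* The centre of the slice moves linearly with t, like a conditional mean. *)
  rewrite -(IH F' (w + (d^-1 * (t - tau)) *: r))//.
  apply: eq_rowint => v; congr (EFin (ppow _ _)); rewrite -addrA -opprD.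
  congr (_ - _); rewrite {1}/qinv opp_row_mx add_row_mx.
  rewrite qf_inv_block// schur_scalar// invmx_scalar1 ?gt_eqF// -/F'.
  rewrite -!raddfB /= -!scalar_mxM tr_scalar_mx -scalar_mxM mul_scalar_mx mxE.
  rewrite mxE eqxx mulr1n /qinv opprD addrA; congr (_ + _); last by rewrite (mulrC (t - tau)).
  by rewrite expr2; ring.
rewrite intZl; last 2 first.
- by rewrite mulr_ge0 ?sqrtr_ge0// ballcst_ge0.
- by move=> t; rewrite lee_fin ppow_ge0.
have s20 : 0 <= s + q%:R / 2 by rewrite addr_ge0// divr_ge0.
have sd : 0 < Num.sqrt d by rewrite sqrtr_gt0.
have -> : (\int[mu]_x (ppow (rho - d^-1 * (x - tau) ^+ 2) (s + q%:R / 2))%:E =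
   (Num.sqrt d * 1)%:E * \int[mu]_t (ppow (rho - t ^+ 2) (s + q%:R / 2))%:E)%E.
  apply: (@int_affineZ R (Num.sqrt d) tau) => // [x|x|x].
  - by rewrite lee_fin ppow_ge0.
  - by rewrite lee_fin ppow_ge0.
  rewrite mul1e; congr (EFin (ppow (_ - _) _)).
  by rewrite addrK exprMn sqr_sqrtr ?ltW// mulrA mulVf ?mul1r// gt_eqF.
rewrite ball_scaling ball_integral// -!EFinM; congr EFin.
rewrite det_block_scalar// -/F' sqrtrM ?ltW//.
have -> : s + q.+1%:R / 2 = s + q%:R / 2 + 2^-1.
  by rewrite -natr1 mulrDl mul1r addrA.
by ring.
Qed.

(** [pdpow_rank1] turns the integrand into a ball integrand with [rho = c^-1]; the powers c^s and
    c^(-s - q/2) combine to c^(-q/2). If E is not positive definite, subtracting a positive rank-one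
    term cannot make it so, and both sides vanish. *)
Lemma rowint_rank1 q (E : 'M[R]_q) (v0 : 'rV[R]_q) (s c : R) : 0 <= s -> 0 < c ->
  rowint (fun v => (pdpow (E - c *: ((v - v0)^T *m (v - v0))) s)%:E) =
  (c `^ (- (q%:R / 2)) * (pdpow E (s + 2^-1) * ballcst q s))%:E.
Proof.
move=> s0 c0; have [Ep|nE] := pselect (pd E); last first.
  rewrite [pdpow E _]pdpow_npd// mul0r mulr0.
  have -> : (fun v => (pdpow (E - c *: ((v - v0)^T *m (v - v0))) s)%:E) =
      (fun v => 0%R%:E * (fun=> 0%:E) v)%E.
    apply/funext => v; rewrite mul0e pdpow_npd// => P; apply: nE.
    have := pd_block_scalar c^-1 (v - v0) E; rewrite invrK invr_gt0 => -[_ H].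
    exact: pd_dr (H (conj c0 P)).
  by rewrite rowintZl// mul0e.
under eq_rowint => v do rewrite pdpow_rank1// EFinM.
rewrite rowintZl ?mulr_ge0 ?powR_ge0//; last by move=> v; rewrite lee_fin ppow_ge0.
rewrite rowint_ball// -EFinM; congr EFin; rewrite pdpow_pd//.
have D0 := det_gt0 Ep; have Dn : \det E != 0 by rewrite gt_eqF.
have cn : c != 0 by rewrite gt_eqF.
have -> : \det E `^ (s + 2^-1) = \det E `^ s * Num.sqrt (\det E).
  by rewrite powRD ?Dn ?implybT// powR12_sqrt// ltW.
rewrite ppow_pos ?invr_gt0//.
have -> : c^-1 `^ (s + q%:R / 2) = (c `^ s)^-1 * c `^ (- (q%:R / 2)).
  rewrite -(powR_inv1 (ltW c0)) -powRrM mulN1r opprD powRD ?cn ?implybT//.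
  by rewrite powRN.
by field; rewrite gt_eqF ?powR_gt0.
Qed.

End BallIntegral.

Section MatrixBeta.
Context {R : realType}.
Notation mu := (@lebesgue_measure R).

(** One factor for each stage of [symint]: the smaller matrix, the row, whose ball exponent is the
    power of the width produced by the smaller matrix, and the corner, whose exponents are raised by
    q/2 through the row. *)
Fixpoint mbcst (p : nat) (a b : R) : R :=
  if p is q.+1 then mbcst q a b * ballcst q (a + b + q.+1%:R / 2) *
    (Gamma (a + q%:R / 2 + 1) * Gamma (b + q%:R / 2 + 1) /
     Gamma (a + b + q%:R + 2))
  else 1.

Lemma mbcst_ge0 p a b : 0 <= a -> 0 <= b -> 0 <= mbcst p a b.
Proof.
move=> a0 b0; elim: p => [|q IH] //=.
have q0 : 0 <= q%:R :> R by [].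
rewrite !mulr_ge0 ?ballcst_ge0 ?invr_ge0 ?(ltW (Gamma_gt0 _))//.
- by rewrite !addr_ge0// divr_ge0.
- by lra.
- by lra.
- by lra.
Qed.

(** Completing the square in y. It merges the rank-one corrections in the Schur complements of X - L
    and U - X into a single square plus a term free of y. *)
Lemma rank1_parallel q (x d : R) (y w : 'rV[R]_q) : x != 0 -> d != 0 -> d - x != 0 ->
  x^-1 *: (y^T *m y) + (d - x)^-1 *: ((w - y)^T *m (w - y)) =
  d^-1 *: (w^T *m w) + (d / (x * (d - x))) *:
     ((y - (x / d) *: w)^T *m (y - (x / d) *: w)).
Proof.
move=> x0 d0 dx0; apply/matrixP => i j.
rewrite !mxE !big_ord1 !mxE; field; by rewrite x0 d0 dx0.
Qed.

Lemma beta_translate (a b l u : R) : 0 <= a -> 0 <= b ->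
  (\int[mu]_t (ppow (t - l) a * ppow (u - t) b)%:E =
  (ppow (u - l) (a + b + 1) *
   (Gamma (a + 1) * Gamma (b + 1) / Gamma (a + b + 2)))%:E)%E.
Proof.
move=> a0 b0; rewrite EFinM -beta_integral// -beta_scaling.
rewrite (@int_affineZ R 1 l 1 _ (fun t => (ppow (u - l - t) b * ppow t a)%:E)) ?mulr1 ?mul1e//.
- by move=> t; rewrite lee_fin mulr_ge0 ?ppow_ge0.
- by move=> t; rewrite lee_fin mulr_ge0 ?ppow_ge0.
move=> t; rewrite mul1e mul1r addrK mulrC; congr (EFin (ppow _ _ * _)); ring.
Qed.

Lemma block_scalarB q (x y : R) (v w : 'rV[R]_q) (Y Z : 'M[R]_q) :
  block_mx (x%:M : 'M[R]_1) v v^T Y - block_mx y%:M w w^T Z =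
  block_mx (x - y)%:M (v - w) (v - w)^T (Y - Z).
Proof. by rewrite opp_block_mx add_block_mx !raddfB. Qed.

Lemma pdpow_beta_block q (x l u a b : R) (v r r2 : 'rV[R]_q) (Y L U : 'M[R]_q) :
  pdpow (block_mx (x%:M : 'M[R]_1) v v^T Y - block_mx l%:M r r^T L) a *
  pdpow (block_mx (u%:M : 'M[R]_1) r2 r2^T U - block_mx x%:M v v^T Y) b =
  (ppow (x - l) a * ppow (u - x) b) *
  (pdpow (Y - (L + (x - l)^-1 *: ((v - r)^T *m (v - r)))) a *
   pdpow (U - (u - x)^-1 *: ((r2 - v)^T *m (r2 - v)) - Y) b).
Proof.
rewrite !block_scalarB !pdpow_block.
have -> : Y - (L + (x - l)^-1 *: ((v - r)^T *m (v - r))) =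
    Y - L - (x - l)^-1 *: ((v - r)^T *m (v - r)) by rewrite opprD addrA.
have -> : U - (u - x)^-1 *: ((r2 - v)^T *m (r2 - v)) - Y =
    U - Y - (u - x)^-1 *: ((r2 - v)^T *m (r2 - v)) by rewrite addrAC.
exact: mulrACA.
Qed.

(** Keeping both ends arbitrary replaces the matrix substitution that would normalise U - L: in the
    induction the rank-one corrections of the Schur complements are simply absorbed into the ends.
    The cut-off in [pdpow] covers the case of an empty range. *)
Lemma symint_beta p (L U : 'M[R]_p) (a b : R) : 0 <= a -> 0 <= b ->
  L^T = L -> U^T = U ->
  symint (fun X => (pdpow (X - L) a * pdpow (U - X) b)%:E) =
  (pdpow (U - L) (a + b + p.+1%:R / 2) * mbcst p a b)%:E.
Proof.
move=> a0 b0; elim: p L U => [|q IH] L U /=.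
  by rewrite !pdpow_pd ?det_mx00 ?powR1 ?mulr1//; exact: pd0.
move: L U; rewrite -[q.+1]/(1 + q)%N => L U; rewrite -[L]submxK -[U]submxK.
rewrite !tr_block_mx => /eq_block_mx[_ _ + L's] /eq_block_mx[_ _ + U's].
set r := ursubmx L; set r2 := ursubmx U; move=> <- <-.
rewrite [ulsubmx L]mx11_scalar [ulsubmx U]mx11_scalar.
move: (ulsubmx L _ _) (ulsubmx U _ _) => l u.
move: (drsubmx L) (drsubmx U) L's U's r r2 => L' U' L's U's r r2.
pose w := r2 - r; pose d := u - l; pose E' := U' - L' - d^-1 *: (w^T *m w).
pose e := a + b + q.+1%:R / 2.
have e0 : 0 <= e by rewrite /e !addr_ge0// divr_ge0.
have rk (k : R) (z : 'rV[R]_q) : (k *: (z^T *m z))^T = k *: (z^T *m z).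
  by rewrite linearZ /= trmx_mul trmxK.
pose K := mbcst q a b * ballcst q e * pdpow E' (e + 2^-1).
have K0 : 0 <= K by rewrite !mulr_ge0 ?mbcst_ge0 ?ballcst_ge0 ?pdpow_ge0.
transitivity (\int[mu]_t ((K * d `^ (- (q%:R / 2)))%:E *
    (ppow (t - l) (a + q%:R / 2) * ppow (u - t) (b + q%:R / 2))%:E))%E.
  apply: eq_integral => x _.
  (* By induction the remaining block yields a power of the width of its own range, whose ends carry
     the rank-one corrections. *)
  have B (v : 'rV[R]_q) : symint (fun Y : 'M[R]_q =>
      (pdpow (block_mx x%:M v v^T Y - block_mx l%:M r r^T L') a *
       pdpow (block_mx u%:M r2 r2^T U' - block_mx x%:M v v^T Y) b)%:E) =
      ((ppow (x - l) a * ppow (u - x) b)%:E *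
       (pdpow (U' - (u - x)^-1 *: ((r2 - v)^T *m (r2 - v)) -
        (L' + (x - l)^-1 *: ((v - r)^T *m (v - r)))) e * mbcst q a b)%:E)%E.
    rewrite -IH; last 2 first.
    - by rewrite raddfD /= rk L's.
    - by rewrite raddfB /= rk U's.
    rewrite -symintZl; last 2 first.
    - by apply: mulr_ge0; exact: ppow_ge0.
    - by move=> X; rewrite lee_fin; apply: mulr_ge0; exact: pdpow_ge0.
    by apply: eq_symint => Y _; rewrite -EFinM pdpow_beta_block.
  under eq_rowint => v do rewrite B.
  have [xl|xl] := ltP l x; last first.
    under eq_rowint => v do rewrite (@ppow_neg _ (x - l)) ?subr_le0// mul0r.
    rewrite rowintZl//; last by move=> v; rewrite lee_fin mulr_ge0 ?pdpow_ge0 ?mbcst_ge0.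
    by rewrite (@ppow_neg _ (x - l)) ?subr_le0// mul0r mule0 mul0e.
  have [xu|xu] := ltP x u; last first.
    under eq_rowint => v do rewrite (@ppow_neg _ (u - x)) ?subr_le0// mulr0.
    rewrite rowintZl//; last by move=> v; rewrite lee_fin mulr_ge0 ?pdpow_ge0 ?mbcst_ge0.
    by rewrite (@ppow_neg _ (u - x)) ?subr_le0// mulr0 mule0 mul0e.
  have x0 : 0 < x - l by rewrite subr_gt0.
  have u0 : 0 < u - x by rewrite subr_gt0.
  have d0 : 0 < d by rewrite subr_gt0; exact: lt_trans xu.
  pose c := d / ((x - l) * (u - x)).
  have c0 : 0 < c by rewrite divr_gt0// mulr_gt0.
  pose v0 := r + ((x - l) / d) *: w.
  have dx : d - (x - l) = u - x by rewrite /d; ring.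
  (* The square in v is completed around [v0]. What is left, [E'], is the Schur complement of U - L
     and no longer involves the corner x. *)
  have C (v : 'rV[R]_q) : U' - (u - x)^-1 *: ((r2 - v)^T *m (r2 - v)) -
        (L' + (x - l)^-1 *: ((v - r)^T *m (v - r))) =
      E' - c *: ((v - v0)^T *m (v - v0)).
    have := @rank1_parallel q (x - l) d (v - r) w.
    rewrite dx !gt_eqF// => /(_ isT isT isT).
    have -> : w - (v - r) = r2 - v by rewrite /w opprB addrA subrK.
    rewrite -addrA -opprD -/v0 -/c => H.
    rewrite /E' -!addrA -!opprD addrCA; congr (U' - (L' + _)).
    by rewrite addrC -H.
  pose k := ppow (x - l) a * ppow (u - x) b * mbcst q a b.
  have k0 : 0 <= k.
    by apply: mulr_ge0; [apply: mulr_ge0; exact: ppow_ge0|exact: mbcst_ge0].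
  have D (v : 'rV[R]_q) :
    (0 <= (pdpow (E' - c *: ((v - v0)^T *m (v - v0))) e)%:E)%E.
    by rewrite lee_fin; exact: pdpow_ge0.
  transitivity (k%:E * rowint (fun v => (pdpow (E' - c *: ((v - v0)^T *m (v - v0))) e)%:E))%E.
    rewrite -(rowintZl k0 D); apply: eq_rowint => v; rewrite C -!EFinM.
    by congr EFin; rewrite /k [RHS]mulrAC mulrA.
  rewrite /k {k k0 D B C}.
  rewrite rowint_rank1// -!EFinM; congr EFin.
  rewrite !ppowD /K !(ppow_pos _ x0) !(ppow_pos _ u0).
  rewrite /c powRM ?(ltW d0) ?invr_ge0 ?mulr_ge0 ?(ltW x0) ?(ltW u0)//.
  (* The factor c^(-q/2) of the row integral becomes powers q/2 of x - l and u - x, which raise the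
     exponents of the scalar Beta integral. *)
  have -> : ((x - l) * (u - x))^-1 `^ (- (q%:R / 2)) =
      (x - l) `^ (q%:R / 2) * (u - x) `^ (q%:R / 2).
    rewrite -powR_inv1 ?mulr_ge0 ?(ltW x0) ?(ltW u0)// -powRrM mulN1r opprK.
    by rewrite powRM ?(ltW x0) ?(ltW u0).
  by ring.
rewrite intZl; last 2 first.
- by apply: mulr_ge0 => //; exact: powR_ge0.
- by move=> t; rewrite lee_fin; apply: mulr_ge0; exact: ppow_ge0.
have q0 : 0 <= q%:R :> R by [].
rewrite beta_translate; [|lra|lra].
rewrite -EFinM; congr EFin.
rewrite block_scalarB.
rewrite pdpow_block -[(1 + q)%N]/q.+1 -/d -/w -/E' -/e.
have -> : a + q%:R / 2 + (b + q%:R / 2) + 2 = a + b + q%:R + 2 by field.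
have -> : a + b + q.+2%:R / 2 = e + 2^-1 by rewrite /e -natr1; field.
have -> : a + q%:R / 2 + (b + q%:R / 2) + 1 = e + 2^-1 + q%:R / 2.
  by rewrite /e -natr1; field.
rewrite [in LHS]ppowD /K.
have [d0|d0] := ltP 0 d; last by rewrite !(ppow_neg _ d0) !(mul0r, mulr0).
have dp : d `^ (q%:R / 2) != 0 by rewrite gt_eqF ?powR_gt0.
rewrite !(ppow_pos _ d0) powRN.
move: (Gamma _ * Gamma _ / Gamma _) => G.
by field.
Qed.
End MatrixBeta.

(** * Closed forms of the recursive constants *)

Section Constants.
Context {R : realType}.

Lemma pi_powRD (x y : R) : (pi : R) `^ (x + y) = pi `^ x * pi `^ y.
Proof. by rewrite powRD// (gt_eqF (pi_gt0 R)) implybT. Qed.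

(** The quotients of Gamma values telescope. *)
Lemma ballcstE q (s : R) : 0 <= s ->
  ballcst q s = pi `^ (q%:R / 2) * Gamma (s + 1) / Gamma (s + q%:R / 2 + 1).
Proof.
move=> s0; have G x : 1 <= x -> Gamma x != 0 :> R by move=> /Gamma_gt0/lt0r_neq0.
elim: q => [|q IH] /=; first by rewrite mul0r powRr0 addr0 mul1r divff// G// lerDr.
have q0 : 0 <= q%:R :> R by [].
have q1 : q.+1%:R = q%:R + 1 :> R by rewrite natr1.
rewrite IH q1 mulrDl mul1r pi_powRD.
rewrite (powR12_sqrt (pi_ge0 R)) !addrA.
have := G (s + q%:R / 2 + 1) ltac:(lra).
have := G (s + q%:R / 2 + 2^-1 + 1) ltac:(lra).
move: (Gamma (s + q%:R / 2 + 1)) (Gamma (s + q%:R / 2 + 2^-1 + 1)) => x y y0 x0.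
move: (Gamma _) (Num.sqrt _) (_ `^ _) => z u v.
by field; rewrite x0 y0.
Qed.

Lemma mGamma_gt0 p (x : R) : (p%:R + 1) / 2 <= x -> 0 < mGamma p x.
Proof.
move=> px; rewrite mulr_gt0 ?powR_gt0 ?pi_gt0// prodr_gt0// => i _.
apply: Gamma_gt0; have : i.+1%:R <= p%:R :> R by rewrite ler_nat.
by rewrite -natr1; lra.
Qed.

Lemma mGammaS p (x : R) :
  mGamma p.+1 x = pi `^ (p%:R / 2) * Gamma x * mGamma p (x - 2^-1).
Proof.
rewrite /mGamma big_ord_recl mul0r subr0 [RHS]mulrACA -pi_powRD.
have -> : (p.+1 * (p.+1 - 1))%:R / 4 = p%:R / 2 + (p * (p - 1))%:R / 4 :> R.
  case: p => [|p]; first by rewrite !mul0n !mul0r addr0.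
  by rewrite !subn1 /= !natrM -!natr1; field.
congr (_ * (_ * _)); apply: eq_bigr => i _; congr Gamma; rewrite lift0 -natr1; by field.
Qed.

(** Both sides are a product of [p.+1] Gamma values at steps of 1/2, with the last or the first of
    them split off. *)
Lemma mGamma_shift p (x : R) :
  mGamma p x * Gamma (x - p%:R / 2) = Gamma x * mGamma p (x - 2^-1).
Proof.
rewrite /mGamma mulrCA -!mulrA; congr (_ * _).
transitivity (\prod_(i < p.+1) Gamma (x - i%:R / 2)).
  by rewrite big_ord_recr.
rewrite big_ord_recl mul0r subr0; congr (_ * _).
apply: eq_bigr => i _; congr Gamma; rewrite lift0 -natr1; by field.
Qed.

Lemma mbcstE p (a b : R) : 0 <= a -> 0 <= b ->
  mbcst p a b = mBeta p (a + p.+1%:R / 2) (b + p.+1%:R / 2).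
Proof.
move=> a0 b0; elim: p => [|q IH] /=.
  have E x : mGamma 0 x = 1 :> R.
    by rewrite /mGamma big_ord0 mul0n mul0r powRr0 mulr1.
  by rewrite /mBeta !E divr1 mulr1.
have q0 : 0 <= q%:R :> R by [].
have q1 : q.+1%:R = q%:R + 1 :> R by rewrite natr1.
have q2 : q.+2%:R = q%:R + 2 :> R by rewrite -addn2 natrD.
rewrite IH /mBeta !mGammaS ballcstE; last by rewrite q1; lra.
set g := a + b + q%:R + 2.
have -> : a + q.+2%:R / 2 + (b + q.+2%:R / 2) = g by rewrite q2 /g; field.
have -> : a + q.+1%:R / 2 + (b + q.+1%:R / 2) = g - 2^-1 - 2^-1 by rewrite q1 /g; field.
have -> : a + q.+2%:R / 2 - 2^-1 = a + q.+1%:R / 2 by rewrite q1 q2; field.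
have -> : b + q.+2%:R / 2 - 2^-1 = b + q.+1%:R / 2 by rewrite q1 q2; field.
have -> : a + q%:R / 2 + 1 = a + q.+2%:R / 2 by rewrite q2; field.
have -> : b + q%:R / 2 + 1 = b + q.+2%:R / 2 by rewrite q2; field.
have -> : a + b + q.+1%:R / 2 + q%:R / 2 + 1 = g - 2^-1 by rewrite q1 /g; field.
have -> : a + b + q.+1%:R / 2 + 1 = g - 2^-1 - q%:R / 2 by rewrite q1 /g; field.
have gq : (q%:R + 1) / 2 + 1 <= g by rewrite /g; clear -a0 b0 q0; lra.
have M1 : 0 < mGamma q (g - 2^-1) by apply: mGamma_gt0; clear -gq; lra.
have M2 : 0 < mGamma q (g - 2^-1 - 2^-1) by apply: mGamma_gt0; clear -gq; lra.
have G1 : 0 < Gamma g by apply: Gamma_gt0; clear -gq q0; lra.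
have G2 : 0 < Gamma (g - 2^-1) by apply: Gamma_gt0; clear -gq q0; lra.
have H := mGamma_shift q (g - 2^-1).
have P : 0 < (pi : R) `^ (q%:R / 2) by rewrite powR_gt0// pi_gt0.
move: H M1 M2 G1 G2 P.
move: (mGamma q (g - 2^-1)) (mGamma q (g - 2^-1 - 2^-1)) (Gamma g) (Gamma (g - 2^-1)).
move: (Gamma (g - 2^-1 - q%:R / 2)) (pi `^ (q%:R / 2)) => E P M N G G' H M0 N0 G0 G'0 P0.
have -> : E = G' * N / M by rewrite -H; field; rewrite gt_eqF.
by field; rewrite !gt_eqF.
Qed.

End Constants.

(** * Block Hankel matrices *)

Section Hankel.
Context {R : realType} (p : nat).
Implicit Types (T S : nat -> 'M[R]_p) (m n k : nat).

(** This recursion makes the dimensions of [col_mx] and [row_mx] agree by computation, so the block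
    recursions need no casts. *)
Fixpoint hs m : nat := if m is m'.+1 then (hs m' + p)%N else 0%N.

(** On moments, the shift by one multiplies the weight by x. *)
Definition sh k T : nat -> 'M[R]_p := fun i => T (k + i)%N.

Fixpoint hcol m T : 'M[R]_(hs m, p) :=
  if m is m'.+1 then col_mx (hcol m' T) (T m') else 0.

Fixpoint hrect m n T : 'M[R]_(hs m, hs n) :=
  if n is n'.+1 then row_mx (hrect m n' T) (hcol m (sh n' T)) else 0.

(* Multiplication by x on polynomials, from degree < m to degree < m + 1. *)
Fixpoint sigma m : 'M[R]_(hs m.+1, hs m) :=
  if m is m'.+1 then block_mx (sigma m') 0 0 1%:M else 0.

Definition hk m T := hrect m m T.

Definition symseq T := forall k, (T k)^T = T k.

Lemma symseq_sh k T : symseq T -> symseq (sh k T).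
Proof. by move=> H i; exact: H. Qed.

Lemma sh_comm k l T : sh k (sh l T) = sh l (sh k T).
Proof. by apply/funext => i; rewrite /sh addnCA. Qed.

Lemma eq_hcol m T S : (forall i, (i < m)%N -> T i = S i) -> hcol m T = hcol m S.
Proof.
elim: m => [|m IH] H //=; rewrite H// IH// => i im.
by rewrite H// ltnW.
Qed.

Lemma eq_hrect m n T S : (forall i, (i < (m + n).-1)%N -> T i = S i) ->
  hrect m n T = hrect m n S.
Proof.
elim: n => [|n IH] H //=; rewrite addnS /= in H; congr row_mx.
  by apply: IH => i im; apply: H; rewrite (leq_trans im)// leq_pred.
by apply: eq_hcol => i im; apply: H; rewrite addnC ltn_add2r.
Qed.

Lemma hcolB m T S : hcol m (fun i => T i - S i) = hcol m T - hcol m S.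
Proof.
by elim: m => [|m IH] /=; rewrite ?subr0// opp_col_mx add_col_mx IH.
Qed.

Lemma hrectB m n T S : hrect m n (fun i => T i - S i) = hrect m n T - hrect m n S.
Proof.
elim: n => [|n IH] /=; rewrite ?subr0// opp_row_mx add_row_mx IH.
by rewrite -hcolB.
Qed.

Lemma hrect_row m n T : symseq T ->
  hrect m.+1 n T = col_mx (hrect m n T) (hcol n (sh m T))^T.
Proof.
move=> Ts; elim: n => [|n IH] /=.
  by apply/matrixP => i [].
rewrite IH tr_col_mx -[in RHS]block_mxEv -block_mxEh; congr block_mx.
by rewrite /sh Ts addnC.
Qed.

Lemma hrect_tr m n T : symseq T -> (hrect m n T)^T = hrect n m T.
Proof.
move=> Ts; elim: n => [|n IH] /=; first by rewrite trmx0; elim: m => [|m IH] //=; apply/matrixP => -[].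
by rewrite tr_row_mx IH hrect_row.
Qed.

Lemma hk_sym m T : symseq T -> (hk m T)^T = hk m T.
Proof. exact: hrect_tr. Qed.

Lemma hk_rec m T : symseq T -> hk m.+1 T =
  block_mx (hk m T) (hcol m (sh m T)) (hcol m (sh m T))^T (T m.*2).
Proof.
move=> Ts; rewrite /hk /= hrect_row// /sh -addnn.
by rewrite block_mxEh.
Qed.

Lemma hrect_sigma a m T : hrect a m.+1 T *m sigma m = hrect a m (sh 1 T).
Proof.
elim: m => [|m IH]; first by rewrite /= mulmx0.
rewrite -[hrect a m.+2 T]/(row_mx (hrect a m.+1 T) (hcol a (sh m.+1 T))).
rewrite -[sigma m.+1]/(block_mx (sigma m) 0 0 1%:M) mul_row_block !mulmx0.
by rewrite mulmx1 addr0 add0r IH.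
Qed.

Lemma sigma_hcol m T : (sigma m)^T *m hcol m.+1 T = hcol m (sh 1 T).
Proof.
elim: m => [|m IH]; first by rewrite /= trmx0 mul0mx.
rewrite -[hcol m.+2 T]/(col_mx (hcol m.+1 T) (T m.+1)).
rewrite -[sigma m.+1]/(block_mx (sigma m) 0 0 1%:M) tr_block_mx !trmx0 trmx1.
by rewrite mul_block_col !mul0mx mul1mx addr0 add0r IH.
Qed.

Lemma sigma_hrect m b T : (sigma m)^T *m hrect m.+1 b T = hrect m b (sh 1 T).
Proof.
elim: b => [|b IH]; first by rewrite /= mulmx0.
rewrite -[hrect m.+1 b.+1 T]/(row_mx (hrect m.+1 b T) (hcol m.+1 (sh b T))).
by rewrite mul_mx_row IH sigma_hcol sh_comm.
Qed.

Lemma sigma_hk m T : (sigma m)^T *m hk m.+1 T *m sigma m = hk m (sh 2 T).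
Proof. by rewrite sigma_hrect hrect_sigma. Qed.

(** When [hk m T] is positive definite, this is the lower end of the range of [T m.*2] in
    [hk m.+1 T]; it depends only on the earlier entries. *)
Definition hschur m T : 'M[R]_p :=
  (hcol m (sh m T))^T *m invmx (hk m T) *m hcol m (sh m T).

Lemma hschur_sym m T : symseq T -> (hschur m T)^T = hschur m T.
Proof.
move=> Ts; rewrite /hschur !trmx_mul trmxK invmx_sym ?hk_sym//.
by rewrite mulmxA.
Qed.

Lemma eq_hschur m T S : (forall i, (i < m.*2)%N -> T i = S i) -> hschur m T = hschur m S.
Proof.
move=> H; rewrite /hschur /hk; congr (_^T *m invmx _ *m _).
- by apply: eq_hcol => i im; apply: H; rewrite -addnn ltn_add2l.
- by apply: eq_hrect => i im; apply: H; rewrite -addnn (leq_trans im)// leq_pred.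
- by apply: eq_hcol => i im; apply: H; rewrite -addnn ltn_add2l.
Qed.

Lemma pd_hk_rec m T : symseq T ->
  pd (hk m.+1 T) <-> pd (hk m T) /\ pd (T m.*2 - hschur m T).
Proof. by move=> Ts; rewrite hk_rec// pd_schur_ul. Qed.

Lemma det_hk_rec m T : symseq T -> pd (hk m T) ->
  \det (hk m.+1 T) = \det (hk m T) * \det (T m.*2 - hschur m T).
Proof. by move=> Ts Hp; rewrite hk_rec// det_schur_ul ?pd_unit// hk_sym. Qed.

(** On moments, this multiplies the weight by 1 - x. *)
Definition dif T : nat -> 'M[R]_p := fun i => T i - T i.+1.

Lemma symseq_dif T : symseq T -> symseq (dif T).
Proof. by move=> H i; rewrite raddfB /= !H. Qed.

Lemma hk_dif m T : hk m (dif T) = hk m T - hk m (sh 1 T).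
Proof. by rewrite /hk -hrectB. Qed.

(* The two Schur complements of [block_mx (invmx K0) J J^T G], where [J^T K0 J]
   is [hk m.+1 (sh 1 S)] with its last entry moved to the lower end of its
   range, which does not involve [S m.*2.+1]. *)
Lemma width_odd m S : symseq S ->
  pd (hk m (sh 1 S)) -> pd (hk m (dif S)) ->
  pd (hk m.+1 S) -> pd (hk m (sh 1 (dif S))) ->
  let D := S m.*2 - hschur m (dif S) - hschur m (sh 1 S) in
  pd D /\ \det D * \det (hk m (sh 1 S)) * \det (hk m (dif S)) =
          \det (hk m.+1 S) * \det (hk m (sh 1 (dif S))).
Proof.
move=> Ss; set K0 := hk m (sh 1 S); set Y := hk m (dif S); set G := hk m.+1 S.
move=> K0p Yp Gp Zp D.
have S1s := symseq_sh 1 Ss; have ds := symseq_dif Ss.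
have K0u := pd_unit K0p; have K0s := proj1 K0p; have K0ip := pd_inv K0p.
set h := hcol m (sh m (sh 1 S)).
pose J : 'M[R]_(hs m, hs m.+1) := row_mx 1%:M (invmx K0 *m h).
have K0J : K0 *m J = (sigma m)^T *m G.
  by rewrite mul_mx_row mulmx1 mulKVmx// sigma_hrect.
(* Up to congruence by [K0], this complement is the Hankel matrix of weight x(1-x). *)
have E1 : K0 *m (invmx K0 - J *m invmx G *m J^T) *m K0 = hk m (sh 1 (dif S)).
  rewrite mulmxBr mulmxBl mulmxV// mul1mx !mulmxA K0J -!mulmxA.
  have -> : J^T *m K0 = G *m sigma m.
    by rewrite -{1}K0s -trmx_mul K0J trmx_mul trmxK (proj1 Gp).
  rewrite mulKmx ?pd_unit// mulmxA sigma_hk.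
  by rewrite -[sh 1 (dif S)]/(dif (sh 1 S)) hk_dif.
have E2 : G - J^T *m invmx (invmx K0) *m J =
    block_mx Y (hcol m (sh m (dif S))) (hcol m (sh m (dif S)))^T (S m.*2 - hschur m (sh 1 S)).
  rewrite invmxK tr_row_mx trmx1 mul_col_mx mul1mx mul_col_row mulmx1.
  rewrite trmx_mul invmx_sym// mulmxKV// mulKVmx//.
  rewrite /G hk_rec// opp_block_mx add_block_mx mulmx1 -raddfB /= -hcolB /hschur -/h.
  by rewrite mulmxA /Y hk_dif.
have P1 : pd (block_mx (invmx K0) J J^T G).
  apply/pd_schur_dr; split=> //; move: Zp; rewrite -E1 -{1}K0s.
  by move/(pd_congr_unit _ K0u).
have d1 : \det (block_mx (invmx K0) J J^T G) = _ := det_schur_ul _ _ (proj1 K0ip) (pd_unit K0ip).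
have d2 : \det (block_mx (invmx K0) J J^T G) = _ := det_schur_dr _ _ (proj1 Gp) (pd_unit Gp).
have [_ P2] := (pd_schur_ul _ _ _).1 P1.
have DE : S m.*2 - hschur m (sh 1 S) - hschur m (dif S) = D by rewrite /D addrAC.
(* A further complement, with respect to [Y], isolates the width. *)
rewrite E2 in P2 d1; have [_ P3] := (pd_schur_ul _ _ _).1 P2.
have SY : hschur m (dif S) = (hcol m (sh m (dif S)))^T *m invmx Y *m hcol m (sh m (dif S)) by [].
rewrite -SY DE in P3; split=> //.
rewrite [X in _ = _ * X]det_schur_ul ?(proj1 Yp) ?pd_unit// -SY DE in d1.
rewrite -E1 !det_mulmx.
transitivity (\det K0 * \det K0 *
  (\det G * \det (invmx K0 - J *m invmx G *m J^T))); last by ring.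
rewrite -d2 d1 det_inv; field.
by rewrite gt_eqF// det_gt0.
Qed.

(* The two Schur complements of [block_mx K0 G G^T G]: the first is
   [hk m.+1 (sh 1 (dif S))] with [S m.*2.+2] at the lower end of its range. *)
Lemma width_even m S : symseq S ->
  pd (hk m.+1 S) -> pd (hk m (sh 1 (dif S))) ->
  pd (hk m.+1 (sh 1 S)) -> pd (hk m.+1 (dif S)) ->
  let D := S m.*2.+1 - hschur m (sh 1 (dif S)) - hschur m.+1 S in
  pd D /\ \det D * \det (hk m.+1 S) * \det (hk m (sh 1 (dif S))) =
          \det (hk m.+1 (sh 1 S)) * \det (hk m.+1 (dif S)).
Proof.
move=> Ss; set K0 := hk m.+1 S; set Y := hk m _; set G := hk m.+1 (sh 1 S).
set W := hk m.+1 (dif S) => K0p Yp Gp Wp D.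
have S1s := symseq_sh 1 Ss; have ds := symseq_dif Ss.
have K0u := pd_unit K0p; have Gu := pd_unit Gp.
have K0s := proj1 K0p; have Gs := proj1 Gp.
set h := hcol m.+1 (sh m.+1 S).
pose N : 'M[R]_(hs m.+1, hs m.+2) := hrect m.+1 m.+2 S.
have GN : G = N *m sigma m.+1 by rewrite hrect_sigma.
(* The flat extension of [K0]: the Hankel matrix one size larger, with its last entry at the lower
   end. *)
have E0 : N^T *m invmx K0 *m N = block_mx K0 h h^T (hschur m.+1 S).
  rewrite [N]/(row_mx K0 h) tr_row_mx mul_col_mx mul_col_row K0s.
  by rewrite mulmxV// !mul1mx mulmxKV.
have E1 : G^T *m invmx K0 *m G = block_mx (hk m (sh 2 S))
    (hcol m (sh m (sh 2 S))) (hcol m (sh m (sh 2 S)))^T (hschur m.+1 S).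
  rewrite {1 2}GN trmx_mul -!mulmxA (mulmxA (invmx _)) (mulmxA N^T) (mulmxA N^T).
  rewrite E0 -[sigma m.+1]/(block_mx (sigma m) 0 0 1%:M) tr_block_mx !trmx0 trmx1.
  rewrite !mulmx_block !(mul0mx, mulmx0, mul1mx, mulmx1, addr0, add0r).
  rewrite mulmxA sigma_hk sigma_hcol; congr block_mx.
    by rewrite sh_comm.
  rewrite -[LHS]trmxK trmx_mul trmxK sigma_hcol; congr (_^T).
  by rewrite sh_comm.
have E2 : G - G^T *m invmx K0 *m G =
    block_mx Y (hcol m (sh m (sh 1 (dif S)))) (hcol m (sh m (sh 1 (dif S))))^T
     (S m.*2.+1 - hschur m.+1 S).
  rewrite E1 /G hk_rec// opp_block_mx add_block_mx -raddfB /= -hcolB.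
  by rewrite /Y -[sh 1 (dif S)]/(dif (sh 1 S)) hk_dif.
have WE : W = K0 - G *m invmx G *m G^T by rewrite mulmxV// mul1mx Gs /W hk_dif.
have P1 : pd (block_mx K0 G G^T G).
  by apply/pd_schur_dr; split=> //; rewrite -WE.
have d1 : \det (block_mx K0 G G^T G) = _ := det_schur_ul _ _ K0s K0u.
have d2 : \det (block_mx K0 G G^T G) = _ := det_schur_dr _ _ Gs Gu.
have [_ P2] := (pd_schur_ul _ _ _).1 P1.
have DE : S m.*2.+1 - hschur m.+1 S - hschur m (sh 1 (dif S)) = D by rewrite /D addrAC.
rewrite E2 in P2 d1; have [_ P3] := (pd_schur_ul _ _ _).1 P2.
have SY : hschur m (sh 1 (dif S)) = (hcol m (sh m (sh 1 (dif S))))^T *m invmx Y *m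
  hcol m (sh m (sh 1 (dif S))) by [].
rewrite -SY DE in P3; split=> //.
rewrite [X in _ = _ * X]det_schur_ul ?(proj1 Yp) ?pd_unit// -SY DE in d1.
by rewrite -WE d1 in d2; rewrite -d2; ring.
Qed.

End Hankel.

(** * Integration of one moment after the other *)

Section MomentRange.
Context {R : realType} (p : nat).
Implicit Types (T S : nat -> 'M[R]_p) (m n k : nat).

(* For a moment sequence [S], [hankel k.+2 S] and [hankel k.+1 (dif S)] are the
   two Hankel matrices with bottom right block [S k] and [S k.-1 - S k]; their
   weights are 1 and x(1-x) for even [k], x and 1-x for odd [k]. *)
Definition hankel k T := hk k./2 (sh (odd k) T).

Definition hankel_schur k T : 'M[R]_p := hschur k./2 (sh (odd k) T).

Lemma hankel_rec k T : symseq T ->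
  pd (hankel k.+2 T) <-> pd (hankel k T) /\ pd (T k - hankel_schur k T).
Proof.
move=> Ts; rewrite /hankel /hankel_schur /= negbK.
rewrite -[X in T X](odd_double_half k) -[T (_ + _)%N]/(sh (odd k) T k./2.*2).
exact/pd_hk_rec/symseq_sh.
Qed.

Lemma det_hankel_rec k T : symseq T -> pd (hankel k T) ->
  \det (hankel k.+2 T) = \det (hankel k T) * \det (T k - hankel_schur k T).
Proof.
move=> Ts; rewrite /hankel /hankel_schur /= negbK.
rewrite -[X in T X](odd_double_half k) -[T (_ + _)%N]/(sh (odd k) T k./2.*2).
by move=> Hp; rewrite det_hk_rec//; exact: symseq_sh.
Qed.

Definition hankel_pd k S := pd (hankel k.+2 S) /\ pd (hankel k.+1 (dif S)).

Definition moment_pd n S := forall k, (k <= n)%N -> hankel_pd k S.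

(* The range of [S k.+1], as a function of [S 0, ..., S k]. *)
Definition lower k S := hankel_schur k.+1 S.
Definition upper k S := S k - hankel_schur k (dif S).
Definition width k S := upper k S - lower k S.

Lemma moment_pd_hankel k S : moment_pd k S ->
  pd (hankel k.+1 S) /\ pd (hankel k (dif S)).
Proof.
case: k => [|k] H; first by split; exact: pd0.
by have [] := H k (leqnSn k).
Qed.

Lemma width_pd k S : symseq S -> moment_pd k S -> pd (width k S) /\
  \det (width k S) * \det (hankel k.+1 S) * \det (hankel k (dif S)) =
  \det (hankel k.+2 S) * \det (hankel k.+1 (dif S)).
Proof.
move=> Ss PS; have [P1 P2] := moment_pd_hankel PS; have [P3 P4] := PS k (leqnn k).
move: P1 P2 P3 P4; rewrite /width /upper /lower /hankel /hankel_schur.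
have [m] : exists m, k = m.*2 \/ k = m.*2.+1.
  exists k./2; rewrite -{1 3}(odd_double_half k).
  by case: (odd k); [right|left].
case=> -> /=; rewrite ?odd_double /= ?uphalf_double ?doubleK => P1 P2 P3 P4.
  exact: (width_odd Ss P1 P2 P3 P4).
exact: (width_even Ss P1 P2 P3 P4).
Qed.

Definition upd k (X : 'M[R]_p) S : nat -> 'M[R]_p :=
  fun i => if i == k then X else S i.

Lemma symseq_upd k (X : 'M[R]_p) S : symseq S -> X^T = X -> symseq (upd k X S).
Proof. by rewrite /upd => Ss Xs i; case: eqP. Qed.

Lemma eq_hankel_schur k T S : (forall i, (i < k)%N -> T i = S i) ->
  hankel_schur k T = hankel_schur k S.
Proof.
move=> H; apply: eq_hschur => i ik; apply: H.
by rewrite -[X in (_ < X)%N]odd_double_half ltn_add2l.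
Qed.

Lemma eq_hankel k T S : (forall i, (i.+1 < k)%N -> T i = S i) ->
  hankel k T = hankel k S.
Proof.
move=> H; apply: eq_hrect => i ik; apply: H.
rewrite -[X in (_ < X)%N]odd_double_half -addnn -addnS ltn_add2l.
by case: (k./2 + k./2)%N ik.
Qed.

Lemma eq_dif k T S : (forall i, (i <= k)%N -> T i = S i) ->
  forall i, (i < k)%N -> dif T i = dif S i.
Proof. by move=> H i ik; rewrite /dif !H// ltnW. Qed.

Lemma eq_lower k T S : (forall i, (i <= k)%N -> T i = S i) -> lower k T = lower k S.
Proof. by move=> H; apply: eq_hankel_schur => i ik; apply: H. Qed.

Lemma eq_upper k T S : (forall i, (i <= k)%N -> T i = S i) -> upper k T = upper k S.
Proof.
by move=> H; rewrite /upper H// (eq_hankel_schur (eq_dif H)).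
Qed.

Lemma eq_moment_pd k T S : (forall i, (i <= k)%N -> T i = S i) ->
  moment_pd k T -> moment_pd k S.
Proof.
move=> H HT i ik; have [P1 P2] := HT i ik; split.
  rewrite -(eq_hankel (T := T))// => j ji; apply: H.
  by rewrite (leq_trans _ ik).
rewrite -(eq_hankel (T := dif T))// => j ji; apply: (eq_dif H).
by rewrite (leq_trans _ ik).
Qed.

(** Each of the two Hankel conditions of order [k.+1] has a Schur complement that is one side of the
    Loewner interval. *)
Lemma moment_pdS k S : symseq S ->
  moment_pd k.+1 S <-> moment_pd k S /\
     pd (S k.+1 - lower k S) /\ pd (upper k S - S k.+1).
Proof.
move=> Ss; have H : moment_pd k S -> hankel_pd k.+1 S <->
    pd (S k.+1 - lower k S) /\ pd (upper k S - S k.+1).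
  move=> /moment_pd_hankel[P1 P2].
  rewrite /hankel_pd !hankel_rec//; last exact: symseq_dif.
  rewrite /upper /lower /dif (addrAC (S k)); tauto.
split=> [P|[P /(H P) P']].
  have Pk : moment_pd k S by move=> i ik; apply: P; exact: leqW.
  by split=> //; apply/(H Pk)/P.
by move=> i; rewrite leq_eqVlt => /predU1P[->//|]; exact: P.
Qed.

(** Two consecutive determinant identities of [width_pd] are multiplied. A new Hankel determinant is
    the one two orders below times the determinant of a distance to an end, so all Hankel
    determinants cancel. *)
Lemma det_width_rec k S : symseq S -> moment_pd k.+1 S ->
  \det (width k.+1 S) = \det (S k.+1 - lower k S) * \det (upper k S - S k.+1) /
                        \det (width k S).
Proof.
move=> Ss P'; have ds := symseq_dif Ss.
have [P [A B]] := (moment_pdS k Ss).1 P'.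
have [Pw E] := width_pd Ss P; have [Pw' E'] := width_pd Ss P'.
have [P1 P2] := moment_pd_hankel P; have [P3 P4] := moment_pd_hankel P'.
rewrite (det_hankel_rec Ss P1) (det_hankel_rec ds P2) in E'.
have -> : upper k S - S k.+1 = dif S k - hankel_schur k (dif S).
  by rewrite /upper /dif addrAC.
apply: (mulIf (lt0r_neq0 (det_gt0 Pw))); rewrite divfK ?lt0r_neq0 ?det_gt0//.
apply: (mulIf (lt0r_neq0 (det_gt0 P1))); apply: (mulIf (lt0r_neq0 (det_gt0 P2))).
rewrite -!mulrA (mulrA (\det (width k S))) E !mulrA E' /lower; ring.
Qed.

End MomentRange.

Section VolumeRecursion.
Context {R : realType} (p : nat).
Implicit Types (T S : nat -> 'M[R]_p) (m n k : nat).

(** Overwrites the entries k, ..., k+n-1 of [S], the last one innermost, so that each range depends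
    only on entries already set. *)
Fixpoint momint n k (F : (nat -> 'M[R]_p) -> \bar R) S : \bar R :=
  if n is n'.+1 then symint (fun X => momint n' k.+1 F (upd k X S)) else F S.

Definition momind k S : R := if `[< moment_pd k S >] then 1 else 0.

(** With e = r(p+1)/2, the recursion for the widths turns the e-th power of the next determinant
    into a Beta integrand with both exponents e, divided by det D^e. The Beta integral has the power
    2e + (p+1)/2 of det D, so e + (p+1)/2 remains: the same formula for r + 1. *)
Lemma momint_pd r k S : symseq S ->
  momint r k.+1 (fun T => (momind (k + r) T)%:E) S =
  (momind k S * pdpow (width k S) (r%:R * p.+1%:R / 2) *
   \prod_(i < r) mbcst p (i%:R * p.+1%:R / 2) (i%:R * p.+1%:R / 2))%:E.
Proof.
elim: r k S => [|r IH] k S Ss.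
  rewrite /= addn0 big_ord0 mulr1 !mul0r /momind; congr EFin.
  case: asboolP => [P|]; last by rewrite mul0r.
  by rewrite mul1r pdpow_pd ?powRr0//; exact: (width_pd Ss P).1.
pose e : R := r%:R * p.+1%:R / 2; rewrite -/e in IH; set C := \prod_(i < r) _ in IH.
have e0 : 0 <= e by rewrite !mulr_ge0// invr_ge0.
have C0 : 0 <= C.
  by apply: prodr_ge0 => i _; apply: mbcst_ge0; rewrite !mulr_ge0// invr_ge0.
have agree (X : 'M[R]_p) i : (i <= k)%N -> upd k.+1 X S i = S i.
  by rewrite /upd => ik; rewrite ltn_eqF.
rewrite /=; case: (pselect (moment_pd k S)) => [P|nP]; last first.
  have -> : momind k S = 0 by rewrite /momind asboolF.
  rewrite !mul0r.
  rewrite (@eq_symint _ _ _ (fun X => 0%R%:E * (fun=> 0%:E) X)%E).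
    by rewrite symintZl// mul0e.
  move=> X Xs; rewrite addnS -addSn IH; last exact: symseq_upd.
  rewrite mul0e /momind asboolF ?mul0r// => P'; apply: nP.
  apply: (eq_moment_pd (agree X)) => i ik; apply: P'; exact: leqW.
have [Wp _] := width_pd Ss P; have W0 := det_gt0 Wp.
have -> : momind k S = 1 by rewrite /momind asboolT.
rewrite mul1r big_ord_recr /= -/C -/e.
have k0 : 0 <= C * (\det (width k S) `^ e)^-1.
  by rewrite mulr_ge0// invr_ge0 powR_ge0.
transitivity ((C * (\det (width k S) `^ e)^-1)%:E *
    symint (fun X => (pdpow (X - lower k S) e * pdpow (upper k S - X) e)%:E))%E.
  rewrite -symintZl//; last by move=> X; rewrite lee_fin mulr_ge0 ?pdpow_ge0.
  apply: eq_symint => X Xs; have Us := symseq_upd k.+1 Ss Xs.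
  rewrite addnS -addSn IH// -EFinM; congr EFin; rewrite mulrC -[RHS]mulrA; congr (_ * _).
  have UE : upd k.+1 X S k.+1 = X by rewrite /upd eqxx.
  have lE := eq_lower (agree X); have uE := eq_upper (agree X).
  have wE : width k (upd k.+1 X S) = width k S by rewrite /width lE uE.
  have := moment_pdS k Us; rewrite UE lE uE => M.
  rewrite /momind; case: asboolP => [P'|nP'].
    have [_ [A B]] := M.1 P'; have [W' _] := width_pd Us P'.
    rewrite mul1r !pdpow_pd// (det_width_rec Us P') UE lE uE wE.
    rewrite powRM ?invr_ge0 ?mulr_ge0 ?(ltW (det_gt0 _))//.
    rewrite powRM ?(ltW (det_gt0 _))// mulrC; congr (_ * _).
    by rewrite -powR_inv1 ?ltW// -powRrM mulN1r powRN.
  have nAB : ~ (pd (X - lower k S) /\ pd (upper k S - X)).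
    move=> AB; apply/nP'/M; split=> //.
    by apply: eq_moment_pd P => i ik; rewrite agree.
  rewrite mul0r; case: (pselect (pd (X - lower k S))) => A; last first.
    by rewrite (pdpow_npd _ A) mul0r mulr0.
  case: (pselect (pd (upper k S - X))) => B; last by rewrite (pdpow_npd _ B) !mulr0.
  by case: nAB.
rewrite symint_beta//; last 2 first.
- by apply: hschur_sym; exact: symseq_sh.
- by rewrite raddfB /= Ss hschur_sym//; exact/symseq_sh/symseq_dif.
rewrite -/(width k S) -EFinM; congr EFin; rewrite !(pdpow_pd _ Wp).
have -> : e + e + p.+1%:R / 2 = e + r.+1%:R * p.+1%:R / 2.
  by rewrite -[r.+1%:R]natr1 /e; field.
rewrite powRD ?(gt_eqF W0) ?implybT//.
by field; rewrite gt_eqF ?powR_gt0.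
Qed.

End VolumeRecursion.

(** * Iterated Lebesgue integrals over symmetric matrices *)

Section UpperTriangle.
Local Open Scope nat_scope.

(** The upper triangle in row-major order, with the recursion of [symint]. *)
Fixpoint upper_seq (I : Type) q (e : nat -> nat -> I) : seq I :=
  if q is q'.+1 then
    e 0 0 :: [seq e 0 b.+1 | b <- iota 0 q'] ++ upper_seq q' (fun a b => e a.+1 b.+1)
  else [::].

Lemma map_upper_seq (I J : Type) (h : I -> J) q e :
  map h (upper_seq q e) = upper_seq q (fun a b => h (e a b)).
Proof. by elim: q e => [|q IH] e //=; rewrite map_cat IH -map_comp. Qed.

Lemma eq_upper_seq (I : Type) q (e e' : nat -> nat -> I) :
  (forall a b, a <= b < q -> e a b = e' a b) -> upper_seq q e = upper_seq q e'.
Proof.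
elim: q e e' => [|q IH] e e' H //=; rewrite H//; congr (_ :: _ ++ _).
  by apply/eq_in_map => b; rewrite mem_iota => /andP[_ bq]; exact: H.
by apply: IH => a b ab; exact: H.
Qed.

Lemma mem_upper_seq (I : eqType) q (e : nat -> nat -> I) x :
  reflect (exists a b, a <= b < q /\ x = e a b) (x \in upper_seq q e).
Proof.
elim: q e x => [|q IH] e x /=.
  by constructor => -[a [b []]]; rewrite ltn0 andbF.
rewrite inE mem_cat; apply: (iffP or3P) => [[/eqP->|/mapP[b]|/IH[a [b [ab ->]]]]|].
- by exists 0, 0.
- by rewrite mem_iota => /andP[_ bq] ->; exists 0, b.+1.
- by exists a.+1, b.+1.
move=> [[|a] [[|b] [ab ->]]]; [constructor 1|constructor 2| |constructor 3] => //.
  by apply/mapP; exists b; rewrite // mem_iota.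
by apply/(IH (fun a b => e a.+1 b.+1)); exists a, b.
Qed.

Lemma upper_seq_pairs o q : upper_seq q (fun a b => (o + a, o + b)) =
  flatten [seq [seq (a, b) | b <- iota a (o + q - a)] | a <- iota o q].
Proof.
elim: q o => [|q IH] o //=.
rewrite addnS subSn ?leq_addr// addKn /= addn0; congr (_ :: _ ++ _).
  rewrite -[in RHS](addn0 o.+1) iotaDl -map_comp; apply: eq_map => b /=.
  by rewrite addSn addnS.
have := IH o.+1; rewrite addSn => <-.
by apply: eq_upper_seq => a b _; rewrite !addnS !addSn.
Qed.

Lemma filter_upper_pairs p : [seq ab <- [seq (a, b) | a <- iota 0 p, b <- iota 0 p] | ab.1 <= ab.2] =
  upper_seq p (fun a b => (a, b)).
Proof.
rewrite (@eq_upper_seq _ _ _ (fun a b => (0 + a, 0 + b)))// upper_seq_pairs.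
rewrite filter_flatten -map_comp; congr flatten; apply/eq_in_map => a.
rewrite mem_iota add0n => /andP[_ ap] /=.
rewrite filter_map -[in iota 0 p](subnKC (ltnW ap)) iotaD filter_cat add0n.
rewrite (@eq_in_filter _ _ pred0) ?filter_pred0.
  rewrite (@eq_in_filter _ _ predT) ?filter_predT// => b.
  by rewrite mem_iota /= => /andP[].
by move=> b; rewrite mem_iota /= add0n => ba; rewrite leqNgt ba.
Qed.

(** The enumeration of the subtype is the lexicographic list of pairs filtered by a <= b. The
    comparison is made on pairs of naturals through the injection [h]; the size [p.+1] provides the
    default index [u0]. *)
Lemma enum_upper_idx p : exists e : nat -> nat -> upper_idx p.+1,
  enum {: upper_idx p.+1} = upper_seq p.+1 e /\
  forall u : upper_idx p.+1, u = e (val u).1 (val u).2.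
Proof.
pose u0 : upper_idx p.+1 := exist _ (ord0, ord0) isT.
pose e a b : upper_idx p.+1 := insubd u0 (inord a, inord b).
pose h (u : upper_idx p.+1) : nat * nat := ((val u).1 : nat, (val u).2 : nat).
have hinj : injective h.
  move=> u v [/val_inj h1 /val_inj h2]; apply: val_inj.
  by rewrite (surjective_pairing (val u)) h1 h2 -surjective_pairing.
have he a b : a <= b < p.+1 -> h (e a b) = (a, b).
  move=> /andP[ab bp]; rewrite /h /e val_insubd /=.
  by rewrite !inordK ?(leq_ltn_trans ab)// ab /= !inordK ?(leq_ltn_trans ab).
exists e; split; last first.
  move=> u; apply: hinj; rewrite he//; case: u => -[a b] /= ab.
  by rewrite ab ltn_ord.
apply: (inj_map hinj); rewrite map_upper_seq (eq_upper_seq he) -filter_upper_pairs.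
pose h2 (ab : 'I_p.+1 * 'I_p.+1) : nat * nat := (ab.1 : nat, ab.2 : nat).
rewrite -[h]/(h2 \o val) map_comp.
have -> : map val (enum {: upper_idx p.+1}) =
    seq.filter (fun ab : 'I_p.+1 * 'I_p.+1 => ab.1 <= ab.2) (enum {: 'I_p.+1 * 'I_p.+1}).
  transitivity (map val (pmap (insub : _ -> option (upper_idx p.+1))
    (enum {: 'I_p.+1 * 'I_p.+1}))).
    by rewrite [in LHS]enumT [in LHS]unlock [in RHS]enumT.
  rewrite pmap_filter; last exact: insubK.
  by apply: eq_filter => ab; exact: isSome_insub.
have -> : enum {: 'I_p.+1 * 'I_p.+1} =
    [seq (a, b) | a <- enum 'I_p.+1, b <- enum 'I_p.+1].
  by rewrite enumT unlock.
rewrite -val_enum_ord (_ : [seq (a, b) | a <- map val (enum 'I_p.+1), b <- map val (enum 'I_p.+1)] =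
  map h2 [seq (a, b) | a <- enum 'I_p.+1, b <- enum 'I_p.+1]).
  by rewrite filter_map.
by rewrite map_allpairs allpairs_mapl allpairs_mapr.
Qed.
End UpperTriangle.

Section IteratedIntegral.
Context {R : realType}.
Notation mu := (@lebesgue_measure R).

Lemma iter_lebesgue_cat (I : eqType) (s1 s2 : seq I) (f : (I -> R) -> \bar R) x :
  iter_lebesgue (s1 ++ s2) f x = iter_lebesgue s1 (iter_lebesgue s2 f) x.
Proof. by elim: s1 x => [|i s1 IH] x //=; apply: eq_integral => t _; rewrite IH. Qed.

(** [f] and [g] are compared only at points agreeing with [x] off the row, since all other
    coordinates stay frozen while the row is integrated. *)
Lemma iter_lebesgue_row (I : eqType) q (r : nat -> I) (f : (I -> R) -> \bar R)
    (x : I -> R) (g : 'rV[R]_q -> \bar R) :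
  uniq [seq r b | b <- iota 0 q] ->
  (forall (v : 'rV[R]_q) y, (forall b : 'I_q, y (r b) = v ord0 b) ->
    (forall i, i \notin [seq r b | b <- iota 0 q] -> y i = x i) -> f y = g v) ->
  iter_lebesgue [seq r b | b <- iota 0 q] f x = rowint g.
Proof.
elim: q r x g => [|q IH] r x g /=; first by move=> _ H; apply: H => // -[].
have iE : [seq r b | b <- iota 1 q] = [seq r b.+1 | b <- iota 0 q].
  by rewrite -[1%N]addn0 iotaDl -map_comp.
rewrite iE => /andP[r0 ru] H.
apply: eq_integral => t _.
rewrite (IH (fun b => r b.+1) _ (fun v => g (row_mx (t%:M : 'rV[R]_1) v)) ru)//.
move=> v y yv yx; apply: H => [b|i].
  case: (@split_ordP 1 q b) => [b'|b'] ->.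
    rewrite ord1; apply: (etrans _ (esym (row_mxEl _ _ _ _))).
    by rewrite mxE eqxx mulr1n /= yx// eqxx.
  apply: (etrans _ (esym (row_mxEr _ _ _ _))).
  by rewrite -yv /= add1n.
by rewrite inE negb_or => /andP[/negbTE i0 ir]; rewrite yx// i0.
Qed.

Lemma iter_lebesgue_upper (I : eqType) q (e : nat -> nat -> I) (f : (I -> R) -> \bar R)
    (x : I -> R) (g : 'M[R]_q -> \bar R) :
  uniq (upper_seq q e) ->
  (forall (X : 'M[R]_q) y, X^T = X -> (forall a b : 'I_q, (a <= b)%N -> y (e a b) = X a b) ->
    (forall i, i \notin upper_seq q e -> y i = x i) -> f y = g X) ->
  iter_lebesgue (upper_seq q e) f x = symint g.
Proof.
elim: q e x g => [|q IH] e x g.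
  move=> _ H; apply: H => //; first by rewrite trmx0.
  by case.
rewrite [upper_seq _ _]/= => U H; have := U.
rewrite cons_uniq mem_cat negb_or cat_uniq => /andP[/andP[e0r e0s] /and3P[ru /hasPn rs su]].
rewrite [LHS]/=; apply: eq_integral => t _; rewrite iter_lebesgue_cat.
apply: (iter_lebesgue_row (r := fun b => e 0%N b.+1)) => // v y yv yx.
apply: IH => // Y z Ys zY zx; apply: H; first exact: tr_block_sym.
  move=> a b; case: (@split_ordP 1 q a) => a' ->; case: (@split_ordP 1 q b) => b' -> ab.
  - rewrite !ord1; apply: (etrans _ (esym (block_mxEul _ _ _ _ _ _))).
    by rewrite mxE eqxx mulr1n /= zx// yx//= eqxx.
  - rewrite ord1; apply: (etrans _ (esym (block_mxEur _ _ _ _ _ _))).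
    rewrite -yv /= add1n zx//; apply/negP => /rs/negP; apply.
    by apply/mapP; exists (b' : nat) => //; rewrite mem_iota add0n ltn_ord.
  - by move: ab; rewrite [b']ord1.
  - apply: (etrans _ (esym (block_mxEdr _ _ _ _ _ _))).
    by rewrite -zY //= !add1n.
move=> i; rewrite inE mem_cat !negb_or => /and3P[i0 ir is_].
by rewrite zx// yx//= (negbTE i0).
Qed.

End IteratedIntegral.

Section Bridge.
Context {R : realType} (p n : nat).
Implicit Types S : nat -> 'M[R]_p.+1.

Lemma sym_of_coord_upper (y : sym_coord p.+1 n -> R) (j : 'I_n) (X : 'M[R]_p.+1) :
  X^T = X -> (forall u : upper_idx p.+1, y (j, u) = X (val u).1 (val u).2) ->
  sym_of_coord y j = X.
Proof.
move=> Xs yX; apply/matrixP => a b; rewrite mxE.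
case: insubP => [u _ uab|]; last first.
  by rewrite /upper_of; case: (leqP a b) => /= [->|/ltnW ->].
rewrite yX uab /upper_of; case: (leqP a b) => //= _.
by rewrite -{1}Xs mxE.
Qed.

Lemma eq_sym_of_coord (y z : sym_coord p.+1 n -> R) (j : 'I_n) :
  (forall u, y (j, u) = z (j, u)) -> sym_of_coord y j = sym_of_coord z j.
Proof.
move=> yz; apply/matrixP => a b; rewrite !mxE; case: insub => // u; exact: yz.
Qed.

(** The entry 0 of [S] is free here; it is later set to the identity, the normalisation of the
    measure. *)
Lemma iter_lebesgue_momint (F : ('I_n -> 'M[R]_p.+1) -> \bar R) (x : sym_coord p.+1 n -> R) S :
  iter_lebesgue (enum {: sym_coord p.+1 n}) (fun y => F (sym_of_coord y)) x =
  momint n 1 (fun T => F (fun j : 'I_n => T j.+1)) S.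
Proof.
have [e [eE eK]] := enum_upper_idx p.
have -> : enum {: sym_coord p.+1 n} =
    flatten [seq upper_seq p.+1 (fun a b => (j, e a b)) | j <- drop 0 (enum 'I_n)].
  rewrite drop0 enumT unlock /= /prod_enum eE; congr flatten; apply: eq_map => j.
  by rewrite map_upper_seq.
have eU (j : 'I_n) : uniq (upper_seq p.+1 (fun a b => (j, e a b))).
  rewrite -(map_upper_seq (fun u => (j, u))) map_inj_uniq -?eE ?enum_uniq//.
  by move=> u v [].
(* Induction on the number of moments left: those before k are already fixed and agree with [T]. *)
suff H r k : (k + r = n)%N -> forall y T,
    (forall j : 'I_n, (j < k)%N -> sym_of_coord y j = T j.+1) ->
    iter_lebesgue (flatten [seq upper_seq p.+1 (fun a b => (j, e a b)) | j <- drop k (enum 'I_n)])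
      (fun y => F (sym_of_coord y)) y =
    momint r k.+1 (fun T => F (fun j : 'I_n => T j.+1)) T by exact: (H n 0).
elim: r k => [|r IH] k kr y T yT.
  rewrite addn0 in kr; rewrite drop_oversize ?size_enum_ord ?kr//=.
  by congr F; apply/funext => j; apply: yT; rewrite kr.
have kn : (k < n)%N by rewrite -kr addnS ltnS leq_addr.
pose jk := Ordinal kn.
rewrite (drop_nth jk) ?size_enum_ord// (nth_ord_enum jk jk) map_cons.
rewrite -[flatten (_ :: _)]/(_ ++ flatten _) iter_lebesgue_cat.
transitivity (symint (fun X => momint r k.+2
  (fun T => F (fun j : 'I_n => T j.+1)) (upd k.+1 X T))); last by [].
refine (iter_lebesgue_upper (eU jk) _) => X z Xs zX zy.
apply: IH => [|j]; first by rewrite -kr addSnnS.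
rewrite ltnS leq_eqVlt => /predU1P[jk'|jk'].
  have -> : j = jk by apply: val_inj.
  rewrite /upd eqxx; apply: sym_of_coord_upper => // u.
  by rewrite [in LHS](eK u) zX//; case: u => -[a b].
rewrite /upd eqSS ltn_eqF// -yT//; apply: eq_sym_of_coord => u; apply: zy.
apply/negP => /mem_upper_seq[a [b [_ [jj _]]]].
by rewrite jj ltnn in jk'.
Qed.

End Bridge.

(** * Hankel matrices of matrix measures *)

Section Atoms.
Context {R : realType} (p : nat).
Implicit Types (T S : nat -> 'M[R]_p).

(** The block row (I, xI, x^2 I, ...), i.e. evaluation of matrix polynomials at x. *)
Fixpoint vander m (x : R) : 'M[R]_(p, hs p m) :=
  if m is m'.+1 then row_mx (vander m' x) (x ^+ m')%:M else 0.

Lemma hcol_atom m n (c x : R) (A : 'M[R]_p) :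
  hcol m (sh n (fun k => (c * x ^+ k) *: A)) = (c * x ^+ n) *: ((vander m x)^T *m A).
Proof.
elim: m => [|m IH] /=; first by rewrite trmx0 mul0mx scaler0.
rewrite IH tr_row_mx mul_col_mx scale_col_mx; congr col_mx.
by rewrite tr_scalar_mx mul_scalar_mx scalerA /sh exprD mulrA.
Qed.

Lemma hrect_atom m n (c x : R) (A : 'M[R]_p) :
  hrect m n (fun k => (c * x ^+ k) *: A) = c *: ((vander m x)^T *m A *m vander n x).
Proof.
elim: n => [|n IH] /=; first by rewrite mulmx0 scaler0.
rewrite IH hcol_atom mul_mx_row scale_row_mx; congr row_mx.
by rewrite mul_mx_scalar scalerA.
Qed.

Lemma hcolD m T S : hcol m (fun i => T i + S i) = hcol m T + hcol m S.
Proof. by elim: m => [|m IH] /=; rewrite ?addr0// add_col_mx IH. Qed.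

Lemma hrectD m n T S : hrect m n (fun i => T i + S i) = hrect m n T + hrect m n S.
Proof. by elim: n => [|n IH] /=; rewrite ?addr0// add_row_mx IH -hcolD. Qed.

Lemma hcol0 m : hcol m (fun=> 0) = 0 :> 'M[R]_(_, p).
Proof. by elim: m => [|m IH] //=; rewrite IH col_mx0. Qed.

Lemma hrect0 m n : hrect m n (fun=> 0) = 0 :> 'M[R]_(hs p m, _).
Proof. by elim: n => [|n IH] //=; rewrite IH [hcol _ _]hcol0 row_mx0. Qed.

Lemma psdD (q : nat) (A B : 'M[R]_q) : psd A -> psd B -> psd (A + B).
Proof. by move=> Ap Bp v; rewrite mulmxDr mulmxDl mxE addr_ge0. Qed.

Lemma psd_hk_atoms m (I : Type) (r : seq I) (c x : I -> R) (A : I -> 'M[R]_p) :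
  (forall i, 0 <= c i) -> (forall i, psd (A i)) ->
  psd (hk m (fun k => \sum_(i <- r) (c i * x i ^+ k) *: A i)).
Proof.
move=> c0 Ap; elim: r => [|i r IH].
  rewrite (_ : (fun k => _) = fun=> 0); last by apply/funext => k; rewrite big_nil.
  by rewrite /hk hrect0 => v; rewrite mulmx0 mul0mx mxE.
rewrite (_ : (fun k => _) = fun k => (c i * x i ^+ k) *: A i +
    \sum_(i <- r) (c i * x i ^+ k) *: A i); last by apply/funext => k; rewrite big_cons.
rewrite /hk hrectD; apply: psdD => //; rewrite hrect_atom.
by apply: psdZ => //; exact: psd_congr.
Qed.

(** Shift and difference multiply the mass at an atom by x and 1 - x, both nonnegative on [0, 1]. *)
Lemma hankel_psd_atoms k (I : Type) (r : seq I) (c x : I -> R) (A : I -> 'M[R]_p)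
    (T := fun k => \sum_(i <- r) (c i * x i ^+ k) *: A i) :
  (forall i, 0 <= c i) -> (forall i, 0 <= x i <= 1) -> (forall i, psd (A i)) ->
  psd (hankel k T) /\ psd (hankel k (dif T)).
Proof.
move=> c0 x01 Ap; split.
  rewrite /hankel (_ : sh _ _ = fun l =>
      \sum_(i <- r) ((c i * x i ^+ odd k) * x i ^+ l) *: A i).
    apply: psd_hk_atoms => // i; rewrite mulr_ge0// exprn_ge0//.
    by have /andP[] := x01 i.
  by apply/funext => l; apply: eq_bigr => i _; rewrite -mulrA -exprD.
rewrite /hankel (_ : sh _ _ = fun l =>
    \sum_(i <- r) ((c i * x i ^+ odd k * (1 - x i)) * x i ^+ l) *: A i).
  apply: psd_hk_atoms => // i; have /andP[x0 x1] := x01 i.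
  by rewrite !mulr_ge0// ?exprn_ge0// subr_ge0.
apply/funext => l; rewrite /sh /dif -sumrB; apply: eq_bigr => i _.
by rewrite -scalerBl; congr (_ *: _); rewrite exprS exprD; ring.
Qed.

End Atoms.

Section Closedness.
Context {R : realType} (p : nat).
Implicit Types (T S : nat -> 'M[R]_p).

Definition mxbound q r (e : R) (A : 'M[R]_(q, r)) := forall i j, `|A i j| <= e.

Lemma mxbound_hcol m e T : (forall i, (i < m)%N -> mxbound e (T i)) ->
  mxbound e (hcol m T).
Proof.
elim: m => [|m IH] H /=; first by case.
move=> i j; case: (split_ordP i) => i' ->; rewrite ?col_mxEu ?col_mxEd.
  by apply: IH => k km; apply: H; exact: ltnW.
exact: H.
Qed.

Lemma mxbound_hrect m n e T : (forall i, (i < (m + n).-1)%N -> mxbound e (T i)) ->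
  mxbound e (hrect m n T).
Proof.
elim: n => [|n IH] H /=; first by move=> i [].
rewrite addnS /= in H => i j; case: (split_ordP j) => j' ->; rewrite ?row_mxEl ?row_mxEr.
  by apply: IH => k km; apply: H; rewrite (leq_trans km)// leq_pred.
by apply: mxbound_hcol => k km; apply: H; rewrite addnC ltn_add2r.
Qed.

Lemma mxbound_qf q (e : R) (A : 'M[R]_q) (v : 'cV[R]_q) : mxbound e A ->
  `|(v^T *m A *m v) ord0 ord0| <= e * (\sum_i `|v i ord0|) ^+ 2.
Proof.
move=> Ae; rewrite mxE (le_trans (ler_norm_sum _ _ _))//.
rewrite expr2 mulr_sumr mulr_sumr; apply: ler_sum => i _.
rewrite normrM mulrA; apply: ler_wpM2r => //.
rewrite mxE (le_trans (ler_norm_sum _ _ _))// mulr_sumr; apply: ler_sum => j _.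
by rewrite mxE normrM mulrC ler_wpM2r.
Qed.

Lemma mxsubE q r (A B : 'M[R]_(q, r)) i j : (A - B) i j = A i j - B i j.
Proof. by rewrite !mxE. Qed.

(** A negative value of the quadratic form at v would survive a small entrywise perturbation. *)
Lemma psd_hk_closed m T :
  (forall e, 0 < e -> exists S, (forall i, (i < m.*2)%N -> mxbound e (T i - S i)) /\
     psd (hk m S)) -> psd (hk m T).
Proof.
move=> H v; set q := _ ord0 ord0; set s := (\sum_i `|v i ord0|) ^+ 2.
have s0 : 0 <= s by rewrite exprn_ge0// sumr_ge0.
have E e : 0 < e -> - (e * s) <= q.
  move=> /H[S [TS Sp]]; have := Sp v.
  have B : mxbound e (hk m T - hk m S).
    rewrite -hrectB; apply: mxbound_hrect => i im; apply: TS.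
    by rewrite -addnn (leq_trans im)// leq_pred.
  have := mxbound_qf v B; rewrite mulmxBr mulmxBl mxsubE -/q -/s.
  by rewrite ler_norml => /andP[h1 h2] h3; lra.
rewrite leNgt; apply/negP => q0.
have s1 : 0 < s + 1 by rewrite ltr_wpDl.
(* Chosen so that [w * s] stays strictly below [- q]. *)
set w := - q / (s + 1); have w0 : 0 < w by rewrite divr_gt0 ?oppr_gt0.
have wE : w * s + w = - q by rewrite -[X in _ + X]mulr1 -mulrDr divfK ?gt_eqF.
by have := E w w0; lra.
Qed.

End Closedness.

(** * Riemann sums for moments *)

Section Riemann.
Context {R : realType}.
Notation D01 := (`[0%R, 1%R]%classic : set R).

(** The indices run from 0 to N: the last cell is the single point 1. *)
Definition cell (N l : nat) : set R := `[l%:R / N%:R, l.+1%:R / N%:R[ `&` D01.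

Lemma measurable_cell N l : measurable (cell N l).
Proof. by apply: measurableI; exact: measurable_itv. Qed.

Lemma cell_bigU N : (0 < N)%N -> \big[setU/set0]_(l <- iota 0 N.+1) cell N l = D01.
Proof.
move=> N0; have NR : 0 < N%:R :> R by rewrite ltr0n.
rewrite -bigcup_seq; apply/seteqP; split => [x [l _ []]//|x Dx].
have /andP[x0 x1] : 0 <= x <= 1 by move: Dx; rewrite /= in_itv.
have Nx : 0 <= x * N%:R by rewrite mulr_ge0.
have /andP[h1 h2] := truncn_itv Nx.
exists (Num.truncn (x * N%:R)).
  rewrite /mkset mem_iota add0n leq0n andTb ltnS -(ler_nat R) (le_trans h1)//.
  by rewrite -[leRHS]mul1r ler_wpM2r.
by split=> //=; rewrite in_itv/= ler_pdivrMr// ltr_pdivlMr// h1 h2.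
Qed.

Lemma trivIset_cell N : (0 < N)%N -> trivIset [set` iota 0 N.+1] (cell N).
Proof.
move=> N0; have NR : 0 < N%:R :> R by rewrite ltr0n.
apply/trivIsetP => i j _ _ ij; apply/seteqP; split=> // x [[h1 _] [h2 _]].
move: h1 h2; rewrite /= !in_itv/= !ler_pdivrMr// !ltr_pdivlMr//.
move=> /andP[a1 a2] /andP[b1 b2].
have := le_lt_trans a1 b2; have := le_lt_trans b1 a2; rewrite !ltr_nat !ltnS.
by move=> ji ij'; move: ij; rewrite eqn_leq ij' ji.
Qed.

Lemma cell_le_pow N l k x : (0 < N)%N -> cell N l x ->
  (l%:R / N%:R) ^+ k <= x ^+ k <= (l%:R / N%:R) ^+ k + k%:R / N%:R.
Proof.
move=> N0; have NR : 0 < N%:R :> R by rewrite ltr0n.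
move=> [/=]; rewrite !in_itv/= => /andP[]; set y := _ / _ => yx xy /andP[x0 x1].
have y0 : 0 <= y by rewrite divr_ge0.
have xy1 : x - y <= N%:R^-1.
  by rewrite lerBlDl ltW// (lt_le_trans xy)// -natr1 mulrDl mul1r.
apply/andP; split; first exact: lerXn2r.
elim: k => [|k IH]; first by rewrite !expr0 mul0r addr0.
rewrite -natr1 mulrDl mul1r !exprS.
have X1 : x ^+ k <= 1 by rewrite exprn_ile1.
have Xk : 0 <= x ^+ k by rewrite exprn_ge0.
have y1 : y <= 1 by exact: le_trans x1.
(* x^(k+1) - y^(k+1) = (x - y) x^k + y (x^k - y^k), where x and y lie in [0, 1]. *)
have a1 : (x - y) * x ^+ k <= N%:R^-1.
  rewrite (le_trans _ xy1)// -[leRHS]mulr1 ler_wpM2l// subr_ge0//.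
have a2 : y * (x ^+ k - y ^+ k) <= k%:R / N%:R.
  have kN : 0 <= k%:R / N%:R :> R by rewrite divr_ge0.
  have h : x ^+ k - y ^+ k <= k%:R / N%:R by rewrite lerBlDl.
  rewrite (le_trans (ler_wpM2l y0 h))// -[leRHS]mul1r ler_wpM2r//.
by lra.
Qed.

Lemma riemann_moment (nu : {finite_measure set R -> \bar R}) k N (s : R) : (0 < N)%N ->
  s = \sum_(l <- iota 0 N.+1) (l%:R / N%:R) ^+ k * fine (nu (cell N l)) ->
  s <= fine (\int[nu]_(x in D01) (x ^+ k)%:E)%E <= s + k%:R / N%:R * fine (nu D01).
Proof.
move=> N0 sE.
have mc l : measurable (cell N l) := measurable_cell N l.
have mX (D : set R) : measurable_fun D (fun x : R => (x ^+ k)%:E).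
  by apply/measurable_EFinP; apply: measurable_funTS; exact: exprn_measurable.
have kN : 0 <= k%:R / N%:R :> R by rewrite divr_ge0.
have lN l : 0 <= (l%:R / N%:R) ^+ k :> R by rewrite exprn_ge0// divr_ge0.
have X0 l x : cell N l x -> (0 <= (x ^+ k)%:E)%E.
  by move=> /(cell_le_pow k N0)/andP[h _]; rewrite lee_fin (le_trans _ h).
have fc l : nu (cell N l) = (fine (nu (cell N l)))%:E.
  by rewrite fineK// fin_num_measure.
have IE : (\int[nu]_(x in D01) (x ^+ k)%:E = \sum_(l <- iota 0 N.+1) \int[nu]_(x in cell N l) (x ^+ k)%:E)%E.
  rewrite -{1}(cell_bigU N0) ge0_integral_bigsetU//.
  - exact: iota_uniq.
  - exact: trivIset_cell.
  - rewrite cell_bigU// => x /=; rewrite in_itv/= => /andP[x0 _].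
    by rewrite lee_fin exprn_ge0.
have ND : fine (nu D01) = \sum_(l <- iota 0 N.+1) fine (nu (cell N l)).
  apply: EFin_inj; rewrite fineK ?fin_num_measure// -sumEFin.
  rewrite -[LHS]mul1e -integral_cst//.
  rewrite -[X in integral _ X _](cell_bigU N0) ge0_integral_bigsetU//.
  - by apply: eq_bigr => l _; rewrite integral_cst// mul1e; exact: fc.
  - exact: iota_uniq.
  - exact: trivIset_cell.
have B l : (((l%:R / N%:R) ^+ k * fine (nu (cell N l)))%:E <=
     \int[nu]_(x in cell N l) (x ^+ k)%:E <=
   (((l%:R / N%:R) ^+ k + k%:R / N%:R) * fine (nu (cell N l)))%:E)%E.
  rewrite !EFinM -!fc -!integral_cst//; apply/andP; split.
    apply: ge0_le_integral => //.
    - by move=> x _; rewrite lee_fin.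
    - by move=> x /(cell_le_pow k N0)/andP[h _]; rewrite lee_fin.
  apply: ge0_le_integral => //.
  - by move=> x; exact: X0.
  - by move=> x /(cell_le_pow k N0)/andP[_ h]; rewrite lee_fin.
have U : ((s)%:E <= \int[nu]_(x in D01) (x ^+ k)%:E <= (s + k%:R / N%:R * fine (nu D01))%:E)%E.
  rewrite IE ND sE mulr_sumr -big_split /= -!sumEFin.
  apply/andP; split; apply: lee_sum => l _; first by have /andP[] := B l.
  by have /andP[_] := B l; rewrite mulrDl.
have /andP[U1 U2] := U.
have If : (\int[nu]_(x in D01) (x ^+ k)%:E)%E \is a fin_num.
  rewrite fin_numE; apply/andP; split; apply/eqP => h; rewrite h in U1 U2.
    by move: U1; rewrite leeNy_eq.
  by move: U2; rewrite leye_eq.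
by rewrite -!lee_fin fineK.
Qed.

End Riemann.

Section MomentsPsd.
Context {R : realType} (p : nat).
Variables nu1 nu2 : 'I_p -> 'I_p -> {finite_measure set R -> \bar R}.
Hypothesis mu01 : is_matrix_measure01 nu1 nu2.
Notation D01 := (`[0%R, 1%R]%classic : set R).
Notation M := (mmoment nu1 nu2).

(** The mass of each cell is placed at its left end; the factor [1] fits the shape of
    [hankel_psd_atoms]. *)
Definition riemann N k : 'M[R]_p :=
  \sum_(l < N.+1) (1 * (l%:R / N%:R) ^+ k) *: mmeasure nu1 nu2 (cell N l).

Let cellP N l : (mmeasure nu1 nu2 (cell N l))^T = mmeasure nu1 nu2 (cell N l) /\
  psd (mmeasure nu1 nu2 (cell N l)).
Proof. by apply: (proj1 mu01); [exact: measurable_cell|move=> x []]. Qed.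

Lemma riemann_bound : exists2 B, 0 <= B & forall N k, (0 < N)%N ->
  mxbound (k%:R / N%:R * B) (M k - riemann N k).
Proof.
pose B := \sum_a \sum_b (fine (nu1 a b D01) + fine (nu2 a b D01)).
have f0 a b : 0 <= fine (nu1 a b D01) + fine (nu2 a b D01).
  by apply: addr_ge0; apply: fine_ge0; exact: measure_ge0.
have B0 : 0 <= B by rewrite sumr_ge0// => a _; rewrite sumr_ge0.
exists B => // N k N0 a b.
have fB : fine (nu1 a b D01) + fine (nu2 a b D01) <= B.
  rewrite /B (bigD1 a)//= (bigD1 b)//= -addrA lerDl addr_ge0// sumr_ge0//.
  by move=> c _; rewrite sumr_ge0.
have kN : 0 <= k%:R / N%:R :> R by rewrite divr_ge0.
have /andP[a1 a2] := @riemann_moment R (nu1 a b) k N _ N0 erefl.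
have /andP[b1 b2] := @riemann_moment R (nu2 a b) k N _ N0 erefl.
rewrite mxsubE [M k a b]mxE summxE.
set I1 := fine (\int[nu1 a b]_(x in _) _)%E in a1 a2 *.
set I2 := fine (\int[nu2 a b]_(x in _) _)%E in b1 b2 *.
rewrite (_ : \sum_(l < N.+1) _ =
    \sum_(l <- iota 0 N.+1) (l%:R / N%:R) ^+ k * fine (nu1 a b (cell N l)) -
    \sum_(l <- iota 0 N.+1) (l%:R / N%:R) ^+ k * fine (nu2 a b (cell N l))); last first.
  rewrite -sumrB -[in RHS](subn0 N.+1) -/(index_iota 0 N.+1) big_mkord.
  by apply: eq_bigr => l _; rewrite !mxE mul1r mulrBr.
move: (\sum_(l <- _) _) (\sum_(l <- _) _) a1 a2 b1 b2 => s1 s2 a1 a2 b1 b2.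
apply: (@le_trans _ _ (k%:R / N%:R * (fine (nu1 a b D01) + fine (nu2 a b D01)))); last first.
  exact: ler_wpM2l.
rewrite mulrDr; set c1 := k%:R / N%:R * fine (nu1 a b D01) in a2 *.
set c2 := k%:R / N%:R * fine (nu2 a b D01) in b2 *.
have c10 : 0 <= c1 by rewrite mulr_ge0 ?fine_ge0.
have c20 : 0 <= c2 by rewrite mulr_ge0 ?fine_ge0.
by rewrite ler_norml; apply/andP; split; lra.
Qed.

Lemma riemann_approx K e : 0 < e -> exists2 N, (0 < N)%N &
  forall k, (k <= K)%N -> mxbound e (M k - riemann N k).
Proof.
move=> e0; have [B B0 HB] := riemann_bound.
pose N := (Num.truncn (K%:R * B / e)).+1.
have NR : 0 < N%:R :> R by rewrite ltr0n.
exists N => // k kK a b; apply: le_trans (HB N k isT a b) _.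
rewrite mulrAC ler_pdivrMr// (@le_trans _ _ (K%:R * B))//.
  by rewrite ler_wpM2r// ler_nat.
rewrite [leRHS]mulrC -ler_pdivrMr//.
have t0 : 0 <= K%:R * B / e by rewrite !mulr_ge0// invr_ge0 ltW.
by have /andP[_ /ltW] := truncn_itv t0.
Qed.

Lemma mmoment0 : M 0 = 1%:M.
Proof.
rewrite -(proj2 mu01); apply/matrixP => a b; rewrite !mxE.
by congr (fine _ - fine _); under eq_integral => x _ do rewrite expr0;
  rewrite integral_cst// mul1e.
Qed.

Lemma riemann_sym N : symseq (riemann N).
Proof.
by move=> k; rewrite /riemann raddf_sum; apply: eq_bigr => l _ /=; rewrite linearZ /= (cellP N l).1.
Qed.

(** Symmetry is given for the values on Borel sets; it passes to the Riemann sums and then to their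
    limit. *)
Lemma mmoment_sym : symseq M.
Proof.
move=> k; apply/matrixP => a b; rewrite mxE; apply/eqP; rewrite -subr_eq0 -normr_eq0.
set x := `|_|; rewrite eq_le normr_ge0 andbT leNgt; apply/negP => x0.
have e0 : 0 < x / 4 by rewrite divr_gt0.
have [N N0 /(_ k (leqnn k)) H] := riemann_approx k e0.
have := H a b; have := H b a; rewrite !mxsubE.
have -> : riemann N k b a = riemann N k a b by rewrite -[in RHS](riemann_sym N k) mxE.
rewrite !ler_norml => /andP[h1 h2] /andP[h3 h4].
have : x <= x / 2 by rewrite ler_norml; apply/andP; split; lra.
by move=> ?; lra.
Qed.

Lemma hankel_mmoment_psd k : psd (hankel k M) /\ psd (hankel k (dif M)).
Proof.
have R01 N : (0 < N)%N -> forall i : 'I_N.+1, 0 <= (i%:R / N%:R : R) <= 1.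
  move=> N0 i; have NR : 0 < N%:R :> R by rewrite ltr0n.
  by rewrite divr_ge0//= ler_pdivrMr// mul1r ler_nat -ltnS.
have RP N : (0 < N)%N -> psd (hankel k (riemann N)) /\ psd (hankel k (dif (riemann N))).
  move=> N0; apply: hankel_psd_atoms => [//|i|i]; first exact: R01.
  by have [] := cellP N i.
have kE : (odd k + k./2.*2 = k)%N by exact: odd_double_half.
split; apply: psd_hk_closed => e e0.
  have [N N0 H] := riemann_approx k e0.
  exists (sh (odd k) (riemann N)); split; last exact: (RP N N0).1.
  by move=> i im; apply: H; rewrite -[X in (_ <= X)%N]kE leq_add2l ltnW.
(* A difference involves two moments, each approximated to within e/2. *)
have e20 : 0 < e / 2 by rewrite divr_gt0.
have [N N0 H] := riemann_approx k e20.
exists (sh (odd k) (dif (riemann N))); split; last exact: (RP N N0).2.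
move=> i im a b; rewrite /sh /dif.
have k1 : (odd k + i < k)%N by rewrite -[X in (_ < X)%N]kE ltn_add2l.
have := H _ (ltnW k1) a b; have := H _ k1 a b; rewrite !mxsubE.
rewrite !ler_norml => /andP[h1 h2] /andP[h3 h4]; apply/andP; split; lra.
Qed.

End MomentsPsd.

(** * Quadrature *)

Section RealSpectral.
Context {R : realType}.

Lemma Re_sum (I : Type) (r : seq I) (F : I -> R[i]) :
  complex.Re (\sum_(i <- r) F i) = \sum_(i <- r) complex.Re (F i).
Proof. by apply: (big_morph (@complex.Re R)) => // -[a b] [c d]. Qed.

Lemma Im_sum (I : Type) (r : seq I) (F : I -> R[i]) :
  complex.Im (\sum_(i <- r) F i) = \sum_(i <- r) complex.Im (F i).
Proof. by apply: (big_morph (@complex.Im R)) => // -[a b] [c d]. Qed.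

Lemma Re_conjM (z w : R[i]) : complex.Re (Num.conj z * w) =
  complex.Re z * complex.Re w + complex.Im z * complex.Im w.
Proof. by case: z => a b; case: w => c d /=; ring. Qed.

Lemma Re_mul_real (z : R[i]) (x : R) : complex.Re (z * real_complex R x) = complex.Re z * x.
Proof. by case: z => a b /=; ring. Qed.

Lemma Im_mul_real (z : R[i]) (x : R) : complex.Im (z * real_complex R x) = complex.Im z * x.
Proof. by case: z => a b /=; ring. Qed.

(* The [u i] are the real and imaginary parts of a complex orthonormal
   eigenbasis, so they form a tight frame rather than a basis. *)
Lemma real_spectral N (A : 'M[R]_N) : A^T = A ->
  exists (I : finType) (lam : I -> R) (u : I -> 'rV[R]_N),
    (forall i, u i *m A = lam i *: u i) /\ \sum_i (u i)^T *m u i = 1%:M.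
Proof.
move=> As; pose Ac : 'M[R[i]]_N := map_mx (real_complex R) A.
have Areal : Ac \is a mxOver Num.real.
  by apply/mxOverP => i j; rewrite mxE; apply/complex_realP; exists (A i j).
have Aherm : Ac \is hermsymmx.
  by apply: realsym_hermsym => //; apply/is_hermitianmxP; rewrite expr0 scale1r map_mx_id// /Ac map_trmx As.
pose P := spectralmx Ac; pose d := spectral_diag Ac.
have Pu : P \is unitarymx := spectral_unitarymx Ac.
have dreal := mxOverP (hermitian_spectral_diag_real Aherm) ord0.
have AE : P *m Ac = diag_mx d *m P.
  have /orthomx_spectralP E := hermitian_normalmx Aherm.
  by rewrite [X in _ *m X]E -/P -/d !mulmxA mulmxV ?unitarymx_unit// mul1mx.
have U : (P ^t*)%sesqui *m P = 1%:M by rewrite -invmx_unitary// mulVmx// unitarymx_unit.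
exists (bool * 'I_N)%type, (fun i => complex.Re (d ord0 i.2)),
  (fun i => map_mx (if i.1 then @complex.Re R else @complex.Im R) (row i.2 P)).
split.
  move=> [b l]; apply/matrixP => i j; rewrite !mxE /=.
  have /complex_realP[r dr] := dreal l.
  have /matrixP/(_ l j) := AE; rewrite mul_diag_mx !mxE dr.
  case: b => [/(congr1 (@complex.Re R))|/(congr1 (@complex.Im R))].
    rewrite mulrC Re_mul_real Re_sum => E; rewrite [RHS]mulrC -E.
    by apply: eq_bigr => k _; rewrite !mxE Re_mul_real.
  rewrite mulrC Im_mul_real Im_sum => E; rewrite [RHS]mulrC -E.
  by apply: eq_bigr => k _; rewrite !mxE Im_mul_real.
apply/matrixP => a b; have /matrixP/(_ a b) := U; rewrite !mxE.
(* The real part of P^* P = 1 is the sum of the outer products of the real and imaginary parts of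
   the rows of [P]. *)
move=> /(congr1 (@complex.Re R)); rewrite Re_sum.
have -> : complex.Re ((a == b)%:R : R[i]) = (a == b)%:R by case: (a == b).
move=> <-; rewrite summxE.
rewrite (eq_bigr (fun i : bool * 'I_N =>
  let f := if i.1 then @complex.Re R else @complex.Im R in f (P i.2 a) * f (P i.2 b))); last first.
  by move=> i _; rewrite !mxE big_ord1 !mxE.
rewrite -(pair_big xpredT xpredT (fun (c : bool) (l : 'I_N) =>
  let f := if c then @complex.Re R else @complex.Im R in f (P l a) * f (P l b))) /=.
rewrite big_bool -big_split /=; apply: eq_bigr => l _.
by rewrite !mxE Re_conjM.
Qed.

End RealSpectral.

Section Atomic.
Context {R : realType}.
Let atom0 : {nonneg R} * R := (0%:nng, 0).
Local Open Scope ereal_scope.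
Notation D01 := (`[0%R, 1%R]%classic : set R).

Definition atomic (s : seq ({nonneg R} * R)) : set R -> \bar R :=
  msum (fun i => mscale (nth atom0 s i).1 (dirac (nth atom0 s i).2))
    (size s).

HB.instance Definition _ s := Measure.on (atomic s).

Lemma atomicE s A : atomic s A = (\sum_(z <- s) z.1%:num * \1_A z.2)%R%:E.
Proof.
rewrite /atomic /msum -sumEFin [RHS](big_nth atom0) big_mkord.
by apply: eq_bigr => i _; rewrite /mscale /= EFinM.
Qed.

Lemma atomic_finite s : fin_num_fun (atomic s).
Proof. by move=> A _; rewrite atomicE. Qed.

HB.instance Definition _ s := Measure_isFinite.Build _ _ _ (atomic s) (@atomic_finite s).

Lemma integral_atomic s (f : R -> R) : (forall x, 0 <= x -> 0 <= f x)%R ->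
  measurable_fun D01 f -> (forall z, z \in s -> D01 z.2) ->
  \int[atomic s]_(x in D01) (f x)%:E = (\sum_(z <- s) z.1%:num * f z.2)%R%:E.
Proof.
move=> f0 mf sD; rewrite ge0_integral_measure_sum//; last 2 first.
- by move=> x /=; rewrite in_itv/= => /andP[x0 _]; rewrite lee_fin f0.
- exact/measurable_EFinP.
rewrite -sumEFin [RHS](big_nth atom0) big_mkord; apply: eq_bigr => i _.
rewrite ge0_integral_mscale//; last 2 first.
- exact/measurable_EFinP.
- by move=> x /=; rewrite in_itv/= => /andP[x0 _]; rewrite lee_fin f0.
rewrite integral_dirac//; last exact/measurable_EFinP.
rewrite diracE mem_set ?mul1e ?EFinM//; apply: sD.
by rewrite mem_nth.
Qed.

End Atomic.

Section Quadrature.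
Context {R : realType}.

Lemma mxscaleE q r (k : R) (A : 'M[R]_(q, r)) i j : (k *: A) i j = k * A i j.
Proof. by rewrite !mxE. Qed.

(** Here it plays the role of Gram-Schmidt: the inverse of [C] passes to a basis orthonormal for
    [G]. *)
Lemma cholesky N (G : 'M[R]_N) : pd G -> exists2 C, C \in unitmx & G = C^T *m C.
Proof.
elim: N G => [|N IH] G Gp.
  exists 1%:M; first exact: unitmx1.
  by apply/matrixP => -[].
move: G Gp; rewrite -[N.+1]/(1 + N)%N => G; rewrite -[G]submxK.
rewrite [ulsubmx G]mx11_scalar; set g := ulsubmx G _ _; set v := ursubmx G.
set Y := drsubmx G => Gp.
have E : dlsubmx G = v^T.
  by have [+ _] := Gp; rewrite tr_block_mx => /eq_block_mx[_ <- _ _]; rewrite trmxK.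
rewrite E in Gp *; have [Ap Sp] := (pd_schur_ul _ _ _).1 Gp.
have g0 : 0 < g by exact/pd_scalar.
have [C' Cu SE] := IH _ Sp.
exists (block_mx (Num.sqrt g)%:M 0 0 C' *m block_mx 1%:M (invmx g%:M *m v) 0 1%:M).
  rewrite unitmx_mul !unitmxE !det_ublock !det1 mulr1 unitr1 andbT det_scalar1.
  by rewrite unitrM -unitmxE Cu andbT unitfE gt_eqF// sqrtr_gt0.
rewrite block_schur_ul ?(proj1 Ap) ?pd_unit// trmx_mul -!mulmxA; congr (_ *m _).
rewrite !mulmxA; congr (_ *m _); rewrite tr_block_mx !trmx0 mulmx_block.
rewrite !(mul0mx, mulmx0, addr0, add0r) -SE tr_scalar_mx -scalar_mxM -expr2.
by rewrite sqr_sqrtr// ltW.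
Qed.

Variable p : nat.
Implicit Types S : nat -> 'M[R]_p.

(** The coordinates of the matrix monomial x^j I. *)
Fixpoint blk n j : 'M[R]_(hs p n, p) :=
  if n is n'.+1 then
    if j == n' then col_mx 0 1%:M else col_mx (blk n' j) 0
  else 0.

Lemma hrect_blk a n j S : (j < n)%N -> hrect a n S *m blk n j = hcol a (sh j S).
Proof.
elim: n => [|n IH] //=; rewrite ltnS leq_eqVlt; case: eqVneq => [-> _|_ /= jn].
  by rewrite mul_row_col mulmx0 mulmx1 add0r.
by rewrite mul_row_col mulmx0 addr0 IH.
Qed.

Lemma blk_hcol n j S : (j < n)%N -> (blk n j)^T *m hcol n S = S j.
Proof.
elim: n => [|n IH] //=; rewrite ltnS leq_eqVlt; case: eqVneq => [-> _|_ /= jn].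
  by rewrite tr_col_mx mul_row_col trmx0 trmx1 mul0mx mul1mx add0r.
by rewrite tr_col_mx mul_row_col trmx0 mul0mx addr0 IH.
Qed.

(* [B] is the compression of multiplication by x to polynomials of degree at
   most [m], in a basis orthonormal for [G]; its eigenvalues are the nodes. *)
Lemma quadrature m S : pd (hk m.+1 S) -> pd (hk m.+1 (sh 1 S)) ->
  pd (hk m.+1 (dif S)) ->
  exists (I : finType) (x : I -> R) (w : I -> 'rV[R]_p),
    (forall i, 0 <= x i <= 1) /\
    forall k, (k <= m.*2.+1)%N -> S k = \sum_i x i ^+ k *: ((w i)^T *m w i).
Proof.
set G := hk m.+1 S; set K := hk m.+1 (sh 1 S) => Gp Kp; rewrite hk_dif -/G -/K => GKp.
have [C Cu GE] := cholesky Gp.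
pose iC := invmx C; pose B := iC^T *m K *m iC.
have iCi (q : nat) (v : 'M[R]_(_, q)) : iC *m v = 0 -> v = 0.
  by move=> /(congr1 (mulmx C)); rewrite mulKVmx// mulmx0.
have Bp : pd B by apply: pd_congr => // v; exact: iCi.
have iCG : iC^T *m G *m iC = 1%:M.
  by rewrite GE !mulmxA -trmx_mul mulmxV// trmx1 mul1mx mulmxV.
have IBp : pd (1%:M - B).
  have -> : 1%:M - B = iC^T *m (G - K) *m iC by rewrite mulmxBr mulmxBl iCG.
  by apply: pd_congr => // v; exact: iCi.
have [I [lam [u [uB uu]]]] := real_spectral (proj1 Bp).
pose f j := C *m blk m.+1 j.
(* [f j] represents x^j in the orthonormal basis; multiplication by x is exact as long as the degree
   stays at most m. *)
have fB j : (j < m)%N -> B *m f j = f j.+1.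
  move=> jm; rewrite /f mulmxA /B mulmxKV// -mulmxA (hrect_blk _ _ (leqW jm)).
  have -> : hcol m.+1 (sh j (sh 1 S)) = G *m blk m.+1 j.+1 by rewrite /G /hk hrect_blk.
  by rewrite GE !mulmxA -trmx_mul mulmxV// trmx1 mul1mx.
have ffE i j : (i <= m)%N -> (j <= m)%N -> (f i)^T *m f j = S (i + j)%N.
  move=> im jm; rewrite /f trmx_mul -!mulmxA (mulmxA C^T) -GE.
  by rewrite hrect_blk// blk_hcol// /sh addnC.
(* Inner products reach the moments up to order 2m; one factor [B] between them adds the order
   2m+1. *)
have fBfE i j : (i <= m)%N -> (j <= m)%N -> (f i)^T *m (B *m f j) = S (i + j).+1.
  move=> im jm; rewrite /f /B trmx_mul -!mulmxA (mulmxA iC) mulVmx// mul1mx.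
  rewrite (mulmxA C^T) -trmx_mul mulVmx// trmx1 mul1mx hrect_blk// blk_hcol//.
  by rewrite /sh add1n addnC.
clearbody f.
(* A vector of the frame may vanish, and then its eigenvalue is unconstrained; the node is set to 0
   with zero mass. *)
pose x i := if u i == 0 then 0 else lam i.
have ux i : u i *m B = x i *: u i.
  by rewrite /x; case: eqVneq => [->|_]; rewrite ?mul0mx ?scaler0.
have uf i j : (j <= m)%N -> u i *m f j = x i ^+ j *: (u i *m f 0%N).
  elim: j => [|j IH] jm; first by rewrite expr0 scale1r.
  by rewrite -(fB j jm) mulmxA ux -scalemxAl (IH (ltnW jm)) scalerA exprS.
exists I, x, (fun i => u i *m f 0%N); split=> [i|k km].
  rewrite /x; case: eqVneq => [_|u0]; first by rewrite lexx ler01.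
  have uT0 : (u i)^T != 0 by rewrite trmx_eq0.
  (* The Rayleigh quotients of [B] and [1 - B] at this vector place the node between 0 and 1. *)
  have := proj2 Bp _ uT0; have := proj2 IBp _ uT0.
  rewrite trmxK mulmxBr mulmxBl uB mulmx1 -!scalemxAl mxsubE !mxscaleE.
  have : 0 <= (u i *m (u i)^T) ord0 ord0.
    by rewrite mxE sumr_ge0// => j _; rewrite mxE -expr2 sqr_ge0.
  set s := (u i *m _) ord0 ord0; rewrite le_eqVlt => /predU1P[<-|s0].
    by rewrite !mulr0 subr0 ltxx.
  by rewrite subr_gt0 pmulr_lgt0// -[X in _ < X]mul1r ltr_pM2r// => /ltW -> /ltW ->.
have sumE (X : 'M[R]_(p, _)) (Z : 'M[R]_(_, p)) : X *m Z = \sum_i X *m (u i)^T *m (u i *m Z).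
  rewrite -[in LHS](mulmx1 X) -uu mulmx_sumr mulmx_suml.
  by apply: eq_bigr => i _; rewrite !mulmxA.
have W i j a : (a <= m)%N -> (j <= m)%N -> (f a)^T *m (u i)^T *m (u i *m f j) =
    x i ^+ (a + j) *: ((u i *m f 0%N)^T *m (u i *m f 0%N)).
  move=> am jm; rewrite -trmx_mul (uf i a am) (uf i j jm).
  have -> (c : R) (v : 'rV[R]_p) : (c *: v)^T = c *: v^T by rewrite linearZ.
  by rewrite -scalemxAl -scalemxAr scalerA exprD.
have [km'|km'] := leqP k m.
  rewrite -[in LHS](add0n k) -(ffE 0%N k (leq0n m) km') sumE.
  by apply: eq_bigr => i _; rewrite (W i k 0%N (leq0n m) km').
have -> : S k = S (m + (k - m.+1)).+1 by congr S; rewrite -addSn subnKC.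
have kmm : (k - m.+1 <= m)%N by rewrite leq_subLR addSn addnn.
rewrite -(fBfE m _ (leqnn m) kmm) sumE; apply: eq_bigr => i _.
rewrite (mulmxA (u i)) ux -scalemxAl -scalemxAr (W i _ m (leqnn m) kmm) scalerA -exprS.
by rewrite -addSn (subnKC km').
Qed.

End Quadrature.

(** * The interior of the moment space *)

Section Interior.
Context {R : realType} (p : nat).
Implicit Types (T S : nat -> 'M[R]_p) (m n k : nat).

(** The next moment is taken at the midpoint of its Loewner interval; iterated, this gives an
    interior point without exhibiting a measure. *)
Lemma moment_pd_extend k S : symseq S -> moment_pd k S ->
  exists2 X, X^T = X & moment_pd k.+1 (upd k.+1 X S).
Proof.
move=> Ss P; have [Wp _] := width_pd Ss P.
have hp : 0 < 2^-1 :> R by rewrite invr_gt0.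
have W2 := pdZ hp Wp.
pose X := lower k S + 2^-1 *: width k S.
have Xs : X^T = X.
  by rewrite raddfD /= (proj1 W2) hschur_sym//; exact: symseq_sh.
exists X => //; have agree i : (i <= k)%N -> upd k.+1 X S i = S i.
  by rewrite /upd => ik; rewrite ltn_eqF.
apply/(moment_pdS k (symseq_upd k.+1 Ss Xs)); split.
  by apply: eq_moment_pd P => i ik; rewrite agree.
rewrite (eq_lower agree) (eq_upper agree) /upd eqxx; split.
  by rewrite /X addrAC subrr add0r.
have -> : upper k S - X = 2^-1 *: width k S; last by [].
rewrite /X opprD addrA -/(width k S) -[X in X - _]scale1r -scalerBl.
by congr (_ *: _); field.
Qed.

Lemma hankel_schur0 S : hankel_schur 0 S = 0.
Proof. by rewrite /hankel_schur /hschur /= mulmx0. Qed.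

Lemma hankel_schur1 S : hankel_schur 1 S = 0.
Proof. by rewrite /hankel_schur /hschur /= mulmx0. Qed.

Lemma pd1 q : pd (1%:M : 'M[R]_q).
Proof.
split=> [|v v0]; first exact: trmx1.
rewrite mulmx1 lt_neqAle eq_sym; apply/andP; split; last first.
  by rewrite mxE sumr_ge0// => i _; rewrite mxE -expr2 sqr_ge0.
rewrite mxE psumr_neq0; last by move=> i _; rewrite mxE -expr2 sqr_ge0.
apply: contra_neqT v0 => /hasPn H; apply/matrixP => i j; rewrite ord1 [RHS]mxE.
have := H i (mem_index_enum i); rewrite mxE -expr2 lt_neqAle sqr_ge0 andbT negbK.
by rewrite eq_sym sqrf_eq0 => /eqP.
Qed.

Lemma moment_pd0 S : S 0%N = 1%:M -> symseq S -> moment_pd 0 S.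
Proof.
move=> S0 Ss [|//] _; split; last exact: pd0.
apply/hankel_rec => //; split; first exact: pd0.
by rewrite hankel_schur0 subr0 S0; exact: pd1.
Qed.

Lemma moment_pd_nonempty n : exists S, [/\ S 0%N = 1%:M, symseq S & moment_pd n S].
Proof.
elim: n => [|n [S [S0 Ss P]]].
  have H : symseq (fun=> 1%:M : 'M[R]_p) by move=> k; exact: trmx1.
  by exists (fun=> 1%:M); split=> //; exact: moment_pd0.
have [X Xs PX] := moment_pd_extend Ss P.
by exists (upd n.+1 X S); split=> //; exact: symseq_upd.
Qed.

Lemma hcolZ m (a : R) T : hcol m (fun i => a *: T i) = a *: hcol m T.
Proof. by elim: m => [|m IH] /=; rewrite ?scaler0// scale_col_mx IH. Qed.

Lemma hrectZ m n (a : R) T : hrect m n (fun i => a *: T i) = a *: hrect m n T.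
Proof. by elim: n => [|n IH] /=; rewrite ?scaler0// scale_row_mx IH -hcolZ. Qed.

Definition homothety (a : R) (c S : nat -> 'M[R]_p) : nat -> 'M[R]_p :=
  fun i => a *: S i + (1 - a) *: c i.

Lemma hk_homothety m a c S :
  hk m (homothety a c S) = a *: hk m S + (1 - a) *: hk m c.
Proof. by rewrite /hk -!hrectZ -hrectD. Qed.

Lemma dif_homothety a c S : dif (homothety a c S) = homothety a (dif c) (dif S).
Proof.
by apply/funext => i; rewrite /dif /homothety !scalerBr opprD addrACA.
Qed.

(** Hankel matrices are linear in the sequence, and a positive definite matrix plus a positive
    semidefinite one is positive definite. *)
Lemma moment_pd_homothety n a c S : 0 < a < 1 -> symseq S -> moment_pd n c ->
  (forall k, psd (hankel k S) /\ psd (hankel k (dif S))) ->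
  moment_pd n (homothety a c S).
Proof.
move=> /andP[a0 a1] Ss Pc PS k kn; have [C1 C2] := Pc k kn.
have b0 : 0 < 1 - a by rewrite subr_gt0.
have E l T d : hankel l (homothety a d T) = (1 - a) *: hankel l d + a *: hankel l T.
  by rewrite addrC /hankel -hk_homothety.
have Z q (A : 'M[R]_q) : A^T = A -> (a *: A)^T = a *: A by move=> As; rewrite linearZ /= As.
rewrite /hankel_pd dif_homothety !E; split; apply: pdD; try exact: pdZ.
- by apply: Z; apply: hk_sym; exact: symseq_sh.
- by apply: psdZ; [exact: ltW|exact: (PS _).1].
- by apply: Z; apply: hk_sym; exact/symseq_sh/symseq_dif.
- by apply: psdZ; [exact: ltW|exact: (PS _).2].
Qed.

End Interior.

Section Sufficiency.
Context {R : realType} (p : nat).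
Notation D01 := (`[0%R, 1%R]%classic : set R).

Lemma outer_psd (w : 'rV[R]_p) : psd (w^T *m w).
Proof.
move=> v; have -> : v^T *m (w^T *m w) *m v = (w *m v)^T *m (w *m v).
  by rewrite trmx_mul !mulmxA.
move: (w *m v) => y; by rewrite mxE sumr_ge0// => j _; rewrite mxE -expr2 sqr_ge0.
Qed.

Lemma moment_space_quadrature n (I : finType) (x : I -> R) (w : I -> 'rV[R]_p)
    (S : nat -> 'M[R]_p) :
  (forall i, 0 <= x i <= 1) -> S 0%N = 1%:M ->
  (forall k, (k <= n)%N -> S k = \sum_i x i ^+ k *: ((w i)^T *m w i)) ->
  moment_space (fun j : 'I_n => S j.+1).
Proof.
move=> x01 S0 SE.
have pos (r : R) : 0 <= Num.max r 0 by rewrite le_max lexx orbT.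
have posB (r : R) : Num.max r 0 - Num.max (- r) 0 = r.
  have [r0|] := boolP (0 <= r).
    by rewrite (max_l r0) max_r ?oppr_le0// subr0.
  rewrite -ltNge => r0; by rewrite (max_r (ltW r0)) max_l ?oppr_ge0 ?ltW// sub0r opprK.
(* An off-diagonal entry of w^T w may be negative: its positive and negative parts are the masses of
   two atomic measures. *)
pose W i a b := w i ord0 a * w i ord0 b.
pose nu1 a b : {finite_measure set R -> \bar R} :=
  atomic [seq (NngNum (pos (W i a b)), x i) | i <- enum I].
pose nu2 a b : {finite_measure set R -> \bar R} :=
  atomic [seq (NngNum (pos (- W i a b)), x i) | i <- enum I].
have WE i a b : ((w i)^T *m w i) a b = W i a b by rewrite mxE big_ord1 mxE.
have xD i : D01 (x i) by rewrite /= in_itv/=; exact: x01.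
have atE (c : I -> {nonneg R}) A :
    fine (atomic [seq (c i, x i) | i <- enum I] A) =
    \sum_(i <- enum I) (c i)%:num * \1_A (x i).
  by rewrite atomicE /= big_map.
have n1 a b A : fine (nu1 a b A) = _ := atE (fun i => NngNum (pos (W i a b))) A.
have n2 a b A : fine (nu2 a b A) = _ := atE (fun i => NngNum (pos (- W i a b))) A.
have mmE A : mmeasure nu1 nu2 A = \sum_i \1_A (x i) *: ((w i)^T *m w i).
  apply/matrixP => a b; rewrite mxE summxE n1 n2 -sumrB big_enum; apply: eq_bigr => i _ /=.
  by rewrite -mulrBl posB mxE WE mulrC.
have moE k : mmoment nu1 nu2 k = \sum_i x i ^+ k *: ((w i)^T *m w i).
  apply/matrixP => a b; rewrite mxE summxE.
  have H (c : I -> {nonneg R}) :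
     (\int[atomic [seq (c i, x i) | i <- enum I]]_(y in D01) (y ^+ k)%:E =
      (\sum_(i <- enum I) (c i)%:num * x i ^+ k)%:E)%E.
    rewrite integral_atomic; first by rewrite big_map.
    - by move=> y y0; exact: exprn_ge0.
    - exact: exprn_measurable.
    - move=> z /mapP[i _ ->]; exact: xD.
  rewrite /nu1 /nu2 !H /= -sumrB big_enum; apply: eq_bigr => i _ /=.
  by rewrite -mulrBl posB mxE WE mulrC.
exists nu1, nu2; split; last by move=> j; rewrite moE SE.
split=> [A _ _|].
  rewrite mmE; split.
    rewrite raddf_sum; apply: eq_bigr => i _ /=.
    by rewrite linearZ /= trmx_mul trmxK.
  apply: (big_ind (@psd R p)) => [v|M N|i _].
  - by rewrite mulmx0 mul0mx mxE.
  - exact: psdD.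
  - by apply: psdZ; [rewrite indicE ler0n|exact: outer_psd].
rewrite mmE -S0 SE//; apply: eq_bigr => i _.
by rewrite expr0 indicE mem_set.
Qed.

(** Quadrature needs Hankel matrices of one size for the weights 1, x and 1 - x, available when the
    last order is odd. For even n one more moment is added and then forgotten. *)
Lemma moment_pd_subset n (S : nat -> 'M[R]_p) : symseq S -> S 0%N = 1%:M ->
  moment_pd n S -> moment_space (fun j : 'I_n => S j.+1).
Proof.
have odd_case m (T : nat -> 'M[R]_p) : symseq T -> T 0%N = 1%:M ->
    moment_pd m.*2.+1 T -> forall k, (k <= m.*2.+1)%N ->
    moment_space (fun j : 'I_k => T j.+1).
  move=> Ts T0 P k km.
  have [P1 P2] := P _ (leqnn _); have [P3 _] := P _ (leqnSn _).
  move: P1 P2 P3; rewrite /hankel /= ?odd_double /= ?doubleK ?uphalf_double => P1 P2 P3.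
  have [I [x [w [x01 H]]]] := quadrature P3 P1 P2.
  by apply: moment_space_quadrature x01 T0 _ => l lk; apply: H; exact: leq_trans km.
move=> Ss S0 P; have := odd_double_half n; case: (odd n) => /= nE.
  apply: (odd_case n./2) => //; last by rewrite -[in X in (X <= _)%N]nE.
  by rewrite -add1n nE.
have [X Xs PX] := moment_pd_extend Ss P.
have := odd_case n./2 (upd n.+1 X S) (symseq_upd n.+1 Ss Xs) S0.
rewrite -[n./2.*2]add0n nE => /(_ PX n (leqnSn n)).
congr moment_space; apply/funext => j; rewrite /upd eqSS ltn_eqF//.
Qed.

End Sufficiency.

(** * Monotonicity and scaling of the iterated integrals *)

Section MonotonicityAndScaling.
Context {R : realType}.
Local Open Scope ereal_scope.

Lemma le_rowint q (f g : 'rV[R]_q -> \bar R) : (forall v, 0 <= f v) ->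
  (forall v, f v <= g v) -> rowint f <= rowint g.
Proof.
elim: q f g => [|q IH] f g f0 fg /=; first exact: fg.
by apply: le_int => t; [exact: rowint_ge0|exact: IH].
Qed.

Lemma le_symint p (f g : 'M[R]_p -> \bar R) : (forall X, 0 <= f X) ->
  (forall X, X^T = X -> f X <= g X) -> symint f <= symint g.
Proof.
elim: p f g => [|q IH] f g f0 fg /=; first by apply: fg; rewrite trmx0.
apply: le_int => t; first by apply: rowint_ge0 => v; exact: symint_ge0.
apply: le_rowint => v; first exact: symint_ge0.
by apply: IH => // Y Ys; apply: fg; exact: tr_block_sym.
Qed.

Lemma rowint_affine q (a : R) (w : 'rV[R]_q) (f : 'rV[R]_q -> \bar R) : (0 < a)%R ->
  (forall v, 0 <= f v) ->
  rowint (fun v => f (a *: v + w)%R) = (a^-1 ^+ q)%:E * rowint f.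
Proof.
move=> a0; have ai : (0 <= a^-1)%R by rewrite invr_ge0 ltW.
elim: q w f => [|q IH] w f f0 /=.
  by rewrite expr0 mul1e; congr f; apply/matrixP => i [].
move: w f f0; rewrite -[q.+1]/(1 + q)%N => w f f0.
rewrite -[w]hsubmxK [lsubmx w]mx11_scalar; set b := lsubmx w _ _; set c := rsubmx w.
pose F t := rowint (fun v => f (row_mx (t%:M : 'rV[R]_1) v)).
have F0 t : 0 <= F t by exact: rowint_ge0.
transitivity (\int[lebesgue_measure]_t ((a^-1 ^+ q)%:E * F (a * t + b)%R)).
  apply: eq_integral => t _; rewrite -(IH c)//; apply: eq_rowint => v; congr f.
  by rewrite scale_row_mx add_row_mx scale_scalar_mx -raddfD.
rewrite intZl ?exprn_ge0//.
by rewrite (int_affine b a0 F0) muleA -EFinM -exprSr.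
Qed.

(** p(p+1)/2, the number of independent entries. *)
Fixpoint symdim p := if p is q.+1 then (q.+1 + symdim q)%N else 0%N.

Lemma symint_affine p (a : R) (W : 'M[R]_p) (f : 'M[R]_p -> \bar R) : (0 < a)%R ->
  W^T = W -> (forall X, 0 <= f X) ->
  symint (fun X => f (a *: X + W)%R) = (a^-1 ^+ symdim p)%:E * symint f.
Proof.
move=> a0; have ai : (0 <= a^-1)%R by rewrite invr_ge0 ltW.
elim: p W f => [|q IH] W f Ws f0 /=.
  by rewrite expr0 mul1e; congr f; apply/matrixP => -[].
move: W f Ws f0; rewrite -[q.+1]/(1 + q)%N => W f Ws f0.
have {Ws} : W = block_mx (ulsubmx W) (ursubmx W) (ursubmx W)^T (drsubmx W) /\
    (drsubmx W)^T = drsubmx W.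
  have := Ws; rewrite -{1 2}[W]submxK tr_block_mx => /eq_block_mx[_ _ E ->].
  by split=> //; rewrite E submxK.
rewrite [ulsubmx W]mx11_scalar; move: (ulsubmx W _ _) (ursubmx W) (drsubmx W) => b w V.
move=> [-> Vs].
pose F t v := symint (fun Y => f (block_mx (t%:M : 'M[R]_1) v v^T Y)).
have F0 t v : 0 <= F t v by exact: symint_ge0.
pose H t := rowint (F t).
have H0 t : 0 <= H t by exact: rowint_ge0.
transitivity (\int[lebesgue_measure]_t ((a^-1 ^+ (q + symdim q))%:E * H (a * t + b)%R)).
  apply: eq_integral => t _; rewrite exprD EFinM -muleA muleC -muleA [X in _ * X]muleC.
  rewrite -(rowint_affine w a0 (F0 _)) -rowintZl ?exprn_ge0//.
  apply: eq_rowint => v; rewrite -(IH V)//; apply: eq_symint => Y _; congr f.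
  rewrite scale_block_mx add_block_mx scale_scalar_mx -[(_%:M + b%:M)%R]raddfD /=.
  have -> : (a *: v + w)^T = (a *: v^T + w^T)%R by rewrite raddfD /= linearZ.
  by [].
rewrite (intZl (exprn_ge0 _ ai) (fun t => H0 (a * t + b)%R)).
by rewrite (int_affine b a0 H0) muleA -EFinM -exprSr.
Qed.

Variable p : nat.
Implicit Types (S : nat -> 'M[R]_p).

(** Integration starts at [k.+1], so the entry 0 is never overwritten and the comparison is only
    made where it is the identity. *)
Lemma le_momint r k (F G : (nat -> 'M[R]_p) -> \bar R) S :
  (forall T, 0 <= F T) ->
  (forall T, symseq T -> T 0%N = 1%:M%R -> F T <= G T) ->
  symseq S -> S 0%N = 1%:M%R -> momint r k.+1 F S <= momint r k.+1 G S.
Proof.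
move=> F0 FG; have M0 s j T : 0 <= momint s j F T.
  by elim: s j T => [|s IH] j T //=; apply: symint_ge0.
elim: r k S => [|r IH] k S Ss S0 /=; first exact: FG.
by apply: le_symint => // X Xs; apply: IH => //; exact: symseq_upd.
Qed.

(** The homothety acts entry by entry, so it is an affine substitution in each moment separately. *)
Lemma momint_homothety r k a c (F : (nat -> 'M[R]_p) -> \bar R) S :
  (0 < a)%R -> symseq c -> (forall T, 0 <= F T) ->
  momint r k (fun T => F (homothety a c T)) S =
  (a^-1 ^+ (symdim p * r))%:E * momint r k F (homothety a c S).
Proof.
move=> a0 cs F0; have M0 s j T : 0 <= momint s j F T.
  by elim: s j T => [|s IH] j T //=; apply: symint_ge0.
have ai : (0 <= a^-1)%R by rewrite invr_ge0 ltW.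
elim: r k S => [|r IH] k S /=; first by rewrite muln0 expr0 mul1e.
transitivity (symint (fun X => (a^-1 ^+ (symdim p * r))%:E *
    momint r k.+1 F (upd k (a *: X + (1 - a) *: c k) (homothety a c S))%R)).
  apply: eq_symint => X _; rewrite IH; congr (_ * momint _ _ _ _).
  by apply/funext => i; rewrite /homothety /upd; case: eqP => // ->.
rewrite symintZl ?exprn_ge0//.
rewrite (@symint_affine _ a ((1 - a) *: c k)%R
  (fun X => momint r k.+1 F (upd k X (homothety a c S))))//; last first.
  by rewrite linearZ /= cs.
by rewrite muleA -EFinM -exprD mulnS addnC.
Qed.

End MonotonicityAndScaling.

(** The ratios have inverses 1 + 1/(n+1), so the bounds converge by continuity of the N-th power; a
    single bound already makes [v] finite. *)
Lemma homothety_limit (R : realType) (N : nat) (C : R) (v : \bar R) : 0 <= C ->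
  (C%:E <= v)%E -> (forall a, 0 < a < 1 -> (v <= (a^-1 ^+ N * C)%:E)%E) -> v = C%:E.
Proof.
move=> C0 Cv H; apply/eqP; rewrite eq_le Cv andbT.
pose a n : R := (1 + n.+1%:R^-1)^-1.
have a01 n : 0 < a n < 1.
  have h : 0 < n.+1%:R^-1 :> R by rewrite invr_gt0.
  by rewrite invr_gt0 addr_gt0//= invf_lt1 ?addr_gt0// ltrDl.
have [r vr] : exists r, v = r%:E.
  case: v Cv H => [r _ _|_ H|Cv _]; first by exists r.
    by have := H _ (a01 0%N); rewrite leye_eq.
  by move: Cv; rewrite leeNy_eq.
rewrite vr lee_fin; have := @cvg_harmonic R => h.
have h1 : ((fun n => (a n)^-1) @ \oo --> (1 + 0 : R)).
  rewrite (_ : (fun n => (a n)^-1) = fun n => 1 + n.+1%:R^-1); last first.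
    by apply/funext => n; rewrite invrK.
  by apply: cvgD; [exact: cvg_cst|exact: h].
have h2 := cvg_comp _ _ h1 (@exprn_continuous R N (1 + 0)).
have {}h : ((fun n => (a n)^-1 ^+ N * C) @ \oo --> (1 + 0) ^+ N * C).
  by apply: cvgM; [exact: h2|exact: cvg_cst].
rewrite addr0 expr1n mul1r in h.
apply: (cvgr_to_ge h); apply: nearW => n.
by have := H _ (a01 n); rewrite vr lee_fin.
Qed.

Theorem theorem2p1 (R : realType) (p n : nat) (hp : (1 <= p)%N) (hn : (1 <= n)%N) :
  sym_volume (@moment_space R p n) =
  (\prod_(1 <= k < n.+1)
     mBeta p (k%:R * (p.+1)%:R / 2%:R) (k%:R * (p.+1)%:R / 2%:R))%:E.
Proof.
case: p hp => // p _; pose S1 : nat -> 'M[R]_p.+1 := fun=> 1%:M.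
have S1s : symseq S1 by move=> k; exact: trmx1.
pose C := \prod_(i < n) mbcst p.+1 (i%:R * p.+2%:R / 2) (i%:R * p.+2%:R / 2 : R).
have h0 (i : nat) : 0 <= i%:R * p.+2%:R / 2 :> R by rewrite !mulr_ge0// invr_ge0.
(* A Beta argument exceeds its exponent by (p+2)/2, the size being [p.+1]: the factor k comes from
   the exponent (k-1)(p+2)/2. *)
have CE : \prod_(1 <= k < n.+1) mBeta p.+1 (k%:R * p.+2%:R / 2%:R) (k%:R * p.+2%:R / 2%:R) = C.
  rewrite big_add1 /= big_mkord; apply: eq_bigr => i _.
  rewrite (mbcstE _ (h0 i) (h0 i)).
  have -> // : i.+1%:R * p.+2%:R / 2 = i%:R * p.+2%:R / 2 + p.+2%:R / 2 :> R.
  by rewrite -[i.+1%:R]natr1 (mulrDl i%:R) mul1r (mulrDl (i%:R * _)).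
have C0 : 0 <= C by apply: prodr_ge0 => i _; apply: mbcst_ge0; exact: h0.
rewrite CE.
have volE : sym_volume (@moment_space R p.+1 n) =
    momint n 1 (fun T => (\1_(@moment_space R p.+1 n) (fun j : 'I_n => T j.+1))%:E) S1.
  by rewrite -(iter_lebesgue_momint (fun s => (\1_(@moment_space R p.+1 n) s)%:E) (fun=> 0)).
have PE (S : nat -> 'M[R]_p.+1) : symseq S -> S 0%N = 1%:M ->
    momint n 1 (fun T => (momind n T)%:E) S = C%:E.
  move=> Ss S0; have := momint_pd n 0 Ss; rewrite add0n => ->.
  have -> : momind 0 S = 1 by rewrite /momind asboolT//; exact: moment_pd0.
  (* The first moment ranges between 0 and the identity, so no determinant remains. *)
  have -> : width 0 S = 1%:M.
    by rewrite /width /upper /lower hankel_schur0 hankel_schur1 !subr0.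
  by rewrite pdpow_pd ?det1 ?powR1 ?mul1r//; exact: pd1.
have ind0 (T : nat -> 'M[R]_p.+1) : (0 <= (momind n T)%:E)%E.
  by rewrite lee_fin /momind; case: ifP.
apply: (@homothety_limit _ (symdim p.+1 * n)) => //.
  (* Lower bound: the interior is contained in the moment space. *)
  rewrite volE -(PE S1)//; apply: le_momint => // T Ts T0.
  rewrite lee_fin /momind indicE; case: asboolP => [P|_]; last by rewrite ler0n.
  by rewrite mem_set//; exact: moment_pd_subset.
(* Upper bound: the homothety centred at the interior point [c] sends the moment space into the
   interior. *)
move=> a a01; have /andP[a0 _] := a01.
have [c [c0 cs cP]] := @moment_pd_nonempty R p.+1 n.
have hs1 : symseq (homothety a c S1).
  by move=> k; rewrite raddfD /= !linearZ /= S1s cs.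
have hs0 : homothety a c S1 0%N = 1%:M.
  by rewrite /homothety c0 -scalerDl addrC subrK scale1r.
(* The interior integral is the same from every symmetric start with entry 0 the identity, in
   particular from the homothetic image of [S1]. *)
rewrite EFinM -(PE _ hs1 hs0) -momint_homothety// volE.
apply: le_momint => // T Ts T0; rewrite lee_fin indicE; case: (boolP (_ \in _)) => [|_].
  rewrite inE => -[nu1 [nu2 [mu01 E]]].
  have agree i : (i <= n)%N -> mmoment nu1 nu2 i = T i.
    case: i => [|i] lin; first by rewrite (mmoment0 mu01) T0.
    by rewrite (E (Ordinal lin)).
  rewrite /momind asboolT//.
  apply: (@eq_moment_pd _ _ _ (homothety a c (mmoment nu1 nu2))).
    by move=> i lin; rewrite /homothety agree.
  apply: moment_pd_homothety => //; first exact: mmoment_sym.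
  by move=> k; exact: hankel_mmoment_psd.
by have := ind0 (homothety a c T); rewrite lee_fin.
Qed.
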